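(* Let $(M,g)$ be a simple $C^{1,1}$ manifold of dimension $n\ge2$ and let $m\ge1$ be an integer. If $f\in C^{1,1}(M)$ is a symmetric $m$-tensor field with $If=0$, then there is a symmetric $(m-1)$-tensor field $p\in C^{1,1}(M)$ such that $f|_{\partial M}=\sigma\nabla p|_{\partial M}$ and $p|_{\partial M}=0$.
   Context: **Setting.** $M\subseteq\mathbb R^n$ ($n\ge2$) is the closed Euclidean unit ball with its standard smooth structure, and $g$ is a $C^{1,1}$ Riemannian metric on $M$ (components are $C^1$ with Lipschitz first derivatives). $SM=\{(x,v)\in TM: |v|_g=1\}$ is the unit sphere bundle (a $C^{1,1}$ submanifold of $TM$), $\partial(SM)=\{(x,v)\in SM: x\in\partial M\}$, and $\partial_{\mathrm{in}}(SM)$ is the set of inward pointing vectors in $\partial(SM)$. For $z\in SM$, $\gamma_z$ is the unique unit speed geodesic with initial condition $z$, $\phi_t(z)=(\gamma_z(t),\dot\gamma_z(t))$ is the geodesic flow, $X$ its infinitesimal generator, and $[-\tau_-(z),\tau_+(z)]$ the maximal interval of definition of $\gamma_z$ in $M$; $\tau:=\tau_+$ is the travel time function. $N$ is the bundle over $SM$ with fibre $N_{(x,v)}=\{w\in T_xM:\langle w,v\rangle_g=0\}$. On sections $W$ of $N$, $XW(z)=D_tW(\phi_t(z))|_{t=0}$ (covariant derivative along the flow curve). The curvature tensor $R$ of $g$ is defined almost everywhere and is $L^\infty$; it acts on sections of $N$ by $(RW)(x,v)=R(W(x,v),v)v$. $L^2(SM)$, $L^2(N)$ are taken with respect to $\mathrm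 d\Sigma_g=\mathrm dS_x\,\mathrm dV_g(x)$, where $\mathrm dS_x$ is the Riemannian measure of $S_xM$ as a sphere in $(T_xM,g(x))$. $H^1(N,X)$ is the completion of $C^1(N)$ in the norm $(\|W\|_{L^2(N)}^2+\|XW\|_{L^2(N)}^2)^{1/2}$, and $H^1_0(N,X)$ its subspace of elements with zero boundary values on $\partial(SM)$. The global index form is $Q(W)=\|XW\|^2_{L^2(N)}-(RW,W)_{L^2(N)}$ for $W\in H^1_0(N,X)$. **Simple $C^{1,1}$ manifold.** The closed Euclidean unit ball $M\subseteq\mathbb R^n$ equipped with a $C^{1,1}$ Riemannian metric $g$ is a simple $C^{1,1}$ manifold $(M,g)$ if: (A1) there is $\varepsilon>0$ with $Q(W)\ge\varepsilon\|W\|^2_{L^2(N)}$ for all $W\in H^1_0(N,X)$; (A2) any two points of $M$ can be joined by a unique geodesic in the interior of $M$ (apart possibly from its end points), whose length depends continuously on its end points; (A3) $\tau^2$ is Lipschitz on $SM$. **Tensors.** $\nabla$ is the Levi-Civita connection of $g$. For tensor fields, $C^{1,1}(M)$ means that the field is $C^1$ with Lipschitz covariant derivative (equivalently, $C^{1,1}$ components). $\sigma$ is symmetrization: $(\sigma h)_{j_1\cdots j_m}=\frac1{m!}\sum_\pi h_{j_{\pi(1)}\cdots j_{\pi(m)}}$. The restrictions to $\partial M$ are as sections of the full tensor bundle of $M$ over $\partial M$ (not pullbacks to $\partial M$). **X-ray transform.** A symmetric $m$-tensor field $f$ is regarded as the function $f(x,v)=f_x(v,\dots,v)$ on $SM$.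 Its integral function is $u^f(x,v)=\int_0^{\tau(x,v)}f(\phi_t(x,v))\,\mathrm dt$, and its X-ray transform is $If=u^f|_{\partial_{\mathrm{in}}(SM)}$. *)

(* Defs.v *)
From HB Require Import structures.
From mathcomp Require Import all_boot all_order all_algebra all_fingroup.
From mathcomp Require Import all_classical all_reals all_analysis.

Set Implicit Arguments.
Unset Strict Implicit.
Unset Printing Implicit Defensive.

Import Order.TTheory GRing.Theory Num.Theory.
Import numFieldNormedType.Exports.

Local Open Scope classical_set_scope.
Local Open Scope ring_scope.

Section LebesgueMeasure.
Context {R : realType}.
Local Notation RR := (measurableTypeR R).

Section cons_measure.
Variables (n : nat) (mu : {sigma_finite_measure set (n.-tuple RR) -> \bar R}).

Definition tcons (p : RR * n.-tuple RR) : n.+1.-tuple RR :=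
  [tuple of p.1 :: p.2].

Lemma measurable_tcons : measurable_fun setT tcons.
Proof. exact: measurable_cons. Qed.

Definition cons_measure : set (n.+1.-tuple RR) -> \bar R :=
  pushforward (lebesgue_measure \x mu)%E tcons.

Let cons_measure0 : cons_measure set0 = 0%E.
Proof. by rewrite /cons_measure /pushforward preimage_set0 measure0. Qed.

Let cons_measure_ge0 A : (0 <= cons_measure A)%E.
Proof. by rewrite /cons_measure /pushforward; apply: measure_ge0. Qed.

Let cons_measure_additive : semi_sigma_additive cons_measure.
Proof.
move=> F mF tF mUF; rewrite /cons_measure /pushforward preimage_bigcup.
apply: measure_semi_sigma_additive.
- by move=> k; rewrite -[X in measurable X]setTI; exact: measurable_tcons.
- apply/trivIsetP => /= i j _ _ ij; rewrite -preimage_setI.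
  by move/trivIsetP : tF => /(_ _ _ _ _ ij) ->//; rewrite preimage_set0.
- by rewrite -preimage_bigcup -[X in measurable X]setTI; exact: measurable_tcons.
Qed.

HB.instance Definition _ := isMeasure.Build _ _ _ cons_measure
  cons_measure0 cons_measure_ge0 cons_measure_additive.

Let cons_measure_sigma_finite : sigma_finite setT cons_measure.
Proof.
have [F [FT ndF Foo]] :=
  (sigma_finiteP _ _).1 (sigma_finiteT (@lebesgue_measure R)).
have [G [GT ndG Goo]] := (sigma_finiteP _ _).1 (sigma_finiteT mu).
pose uncons (t : n.+1.-tuple RR) : RR * n.-tuple RR :=
  (tnth t ord0, [tuple of behead t]).
have unconsK (p : RR * n.-tuple RR) : uncons (tcons p) = p.
  by case: p => a t; rewrite /uncons /tcons (tnth_nth a) /=; congr pair; apply/val_inj.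
have muncons : measurable_fun setT uncons.
  by apply: measurable_fun_pair;
    [exact: measurable_tnth | exact: measurable_behead].
exists (fun k => uncons @^-1` (F k `*` G k)).
  rewrite predeqE => t; split=> // _.
  have [i _ Fi] : (\bigcup_i F i) (uncons t).1 by rewrite -FT.
  have [j _ Gj] : (\bigcup_i G i) (uncons t).2 by rewrite -GT.
  exists (maxn i j) => //; split.
    by move: (_.1) Fi; exact/subsetPset/ndF/leq_maxl.
  by move: (_.2) Gj; exact/subsetPset/ndG/leq_maxr.
move=> k; have [mF Fk] := Foo k; have [mG Gk] := Goo k; split.
  by rewrite -[X in measurable X]setTI; apply: muncons => //; exact: measurableX.
rewrite /cons_measure /pushforward -comp_preimage.
rewrite (_ : uncons \o tcons = id); last by apply/funext => p; exact: unconsK.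
by rewrite preimage_id product_measure1E// lte_mul_pinfty// ge0_fin_numE.
Qed.

HB.instance Definition _ := Measure_isSigmaFinite.Build _ _ _ cons_measure
  cons_measure_sigma_finite.

End cons_measure.

(* Lebesgue measure on R^n, as the n-fold product of lebesgue_measure. *)
Fixpoint leb (n : nat) : {sigma_finite_measure set (n.-tuple RR) -> \bar R} :=
  match n with
  | 0 => @dirac _ (0.-tuple RR) [tuple] R
  | k.+1 => cons_measure (leb k)
  end.

End LebesgueMeasure.

Section Ball.
Context (R : realType) (n : nat).
Local Notation V := 'rV[R]_n.

Definition sqnorm (x : V) : R := \sum_i x 0 i ^+ 2.

Definition Mball : set V := [set x | sqnorm x <= 1].
Definition Mint : set V := [set x | sqnorm x < 1].
Definition Mbd : set V := [set x | sqnorm x = 1].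

(* Objects on Mball are represented by total functions on R^n of which only
   the restriction to Mball is relevant. C^1 up to the boundary means that the
   representative is differentiable, in R^n, at every point of Mball, with
   derivative continuous on Mball: every C^1 function on the ball has such a
   representative, and at boundary points the derivative depends only on the
   restriction to Mball. Lipschitz conditions are with respect to the max norms
   of 'rV and of products, which are equivalent to the Euclidean ones. *)
Definition pderiv (k : 'I_n) (F : V -> R) (x : V) : R :=
  'D_(delta_mx 0 k : V) F x.

Definition C11 (F : V -> R) : Prop :=
  (forall x, Mball x -> differentiable F x) /\
  (forall k, [lipschitz pderiv k F x | x in Mball]).

End Ball.

Section Metric.
Context (R : realType) (n : nat).
Local Notation V := 'rV[R]_n.
Local Notation TM := ('rV[R]_n * 'rV[R]_n)%type.
Variable g : V -> 'M[R]_n.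

Definition inner (x u v : V) : R := (u *m g x *m v^T) 0 0.

Definition C11_metric : Prop :=
  [/\ forall i j, C11 (fun x => g x i j),
      forall x, Mball x -> (g x)^T = g x &
      forall x v, Mball x -> v != 0 -> 0 < inner x v v].

(* Gamma^i_{jk} *)
Definition christoffel (i j k : 'I_n) (x : V) : R :=
  2^-1 * \sum_l invmx (g x) i l *
    (pderiv j (fun y => g y k l) x + pderiv k (fun y => g y j l) x
     - pderiv l (fun y => g y j k) x).

Definition chris (x u v : V) : V :=
  \row_i \sum_j \sum_k christoffel i j k x * u 0 j * v 0 k.

(* R(d_k, d_l) d_j = sum_i R^i_{jkl} d_i, for
   R(X,Y) = [nabla_X, nabla_Y] - nabla_[X,Y]. Meaningful at the points of
   differentiability of the Lipschitz functions Gamma^i_{jk}, that is almost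
   everywhere on Mball. *)
Definition riemann (i j k l : 'I_n) (x : V) : R :=
  pderiv k (christoffel i l j) x - pderiv l (christoffel i k j) x
  + \sum_p (christoffel i k p x * christoffel p l j x
            - christoffel i l p x * christoffel p k j x).

(* w |-> R(w, v) v *)
Definition curv (z : TM) (w : V) : V :=
  \row_i \sum_j \sum_k \sum_l
    riemann i j k l z.1 * z.2 0 j * w 0 k * z.2 0 l.

Definition SM : set TM := [set z | Mball z.1 /\ inner z.1 z.2 z.2 = 1].
Definition bdSM : set TM := [set z | SM z /\ Mbd z.1].
(* strictly inward: the derivative of sqnorm along z.2 is negative *)
Definition bdinSM : set TM :=
  [set z | bdSM z /\ \sum_i z.1 0 i * z.2 0 i < 0].

(* c t = (gamma t, gamma' t). By the mean value theorem, continuity of c on I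
   makes gamma twice differentiable, with one-sided derivatives, up to the end
   points of I. *)
Definition geodesic_on (I : set R) (c : R -> TM) : Prop :=
  [/\ {within I, continuous c},
      forall t, I t -> Mball (c t).1 &
      forall t, interior I t ->
        is_derive t 1 (fun s => (c s).1) (c t).2 /\
        is_derive t 1 (fun s => (c s).2) (- chris (c t).1 (c t).2 (c t).2)].

Definition tau_plus (z : TM) : \bar R :=
  ereal_sup [set T%:E | T in
    [set T | 0 <= T /\ exists c, c 0 = z /\ geodesic_on `[0, T] c]].

Definition tau_minus (z : TM) : \bar R :=
  ereal_sup [set T%:E | T in
    [set T | 0 <= T /\ exists c, c 0 = z /\ geodesic_on `[- T, 0] c]].

Definition lifespan (z : TM) : set R :=
  [set t | (- tau_minus z <= t%:E)%E /\ (t%:E <= tau_plus z)%E].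

(* t |-> phi_t(z), relevant for t in lifespan z only *)
Definition flow (z : TM) : R -> TM :=
  xget (cst z) [set c | c 0 = z /\ geodesic_on (lifespan z) c].

Definition travel_time (z : TM) : R := fine (tau_plus z).

Definition covderiv (c : R -> TM) (Y : R -> V) (t : R) : V :=
  'D_1 Y t + chris (c t).1 (c t).2 (Y t).

Definition Xder (W : TM -> V) (z : TM) : V :=
  covderiv (flow z) (fun t => W (flow z t)) 0.

Definition section_N (W : TM -> V) : Prop :=
  forall z, SM z -> inner z.1 (W z) z.2 = 0.

Definition C1_N (W : TM -> V) : Prop :=
  [/\ section_N W,
      forall z, SM z -> differentiable W z &
      forall u, {within SM, continuous (fun z => 'd W z u)}].

Definition pt (t : n.-tuple (measurableTypeR R)) : V := \row_i tnth t i.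

(* Polar coordinates on the punctured unit ball of (T_xM, g(x)):
     int_{S_xM} h dS_x
       = n * int_{0 < |v|_g <= 1} h (v / |v|_g) sqrt(det g(x)) dv,
   which together with dV_g = sqrt(det g(x)) dx gives the density n * det g(x)
   of dS_x dV_g below. *)
Definition polar_dom :
    set (n.-tuple (measurableTypeR R) * n.-tuple (measurableTypeR R)) :=
  [set p | Mball (pt p.1) /\ 0 < inner (pt p.1) (pt p.2) (pt p.2) <= 1].

Definition polar
    (p : n.-tuple (measurableTypeR R) * n.-tuple (measurableTypeR R)) : TM :=
  (pt p.1, (Num.sqrt (inner (pt p.1) (pt p.2) (pt p.2)))^-1 *: pt p.2).

Definition int_SM (F : TM -> R) : \bar R :=
  (\int[leb n \x leb n]_(p in polar_dom)
     (n%:R * \det (g (pt p.1)) * F (polar p))%:E)%E.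

Definition ip_N (W W' : TM -> V) : \bar R :=
  int_SM (fun z => inner z.1 (W z) (W' z)).

Definition sqnorm_N (W : TM -> V) : \bar R := ip_N W W.

Definition L2_N (W : TM -> V) : Prop :=
  [/\ section_N W,
      forall i, measurable_fun polar_dom (fun p => W (polar p) 0 i) &
      (sqnorm_N W < +oo)%E].

(* W |-> (W, XW) embeds C^1(N) with the H^1(N,X)-norm isometrically into
   L^2(N) x L^2(N), so the completion H^1(N,X) is the closure of the graph of
   X, and an element of it is a pair (W, Z) with Z in the role of XW.
   H^1_0(N,X) is the closure in it of the C^1 sections that vanish on the
   boundary of SM. *)
Definition H10 (W Z : TM -> V) : Prop :=
  [/\ L2_N W, L2_N Z &
      exists W_ : nat -> TM -> V,
        [/\ forall k, C1_N (W_ k),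
            forall k z, bdSM z -> W_ k z = 0,
            sqnorm_N (fun z => W_ k z - W z) @[k --> \oo] --> 0%E &
            sqnorm_N (fun z => Xder (W_ k) z - Z z) @[k --> \oo] --> 0%E]].

Definition index_form (W Z : TM -> V) : \bar R :=
  (sqnorm_N Z - ip_N (fun z => curv z (W z)) W)%E.

Definition index_coercive : Prop :=
  exists2 e : R, 0 < e &
    forall W Z, H10 W Z -> (e%:E * sqnorm_N W <= index_form W Z)%E.

(* c is, in unit speed parametrization on [0, l], a geodesic from x to y in
   the interior of M, so l is its length. For x = y, l = 0 is the constant
   geodesic. *)
Definition joins (x y : V) (l : R) (c : R -> TM) : Prop :=
  [/\ 0 <= l, geodesic_on `[0, l] c, SM (c 0),
      (c 0).1 = x /\ (c l).1 = y &
      forall t, 0 < t < l -> Mint (c t).1].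

Definition uniquely_joined : Prop :=
  exists2 ell : TM -> R,
    {within [set p | Mball p.1 /\ Mball p.2], continuous ell} &
    forall x y, Mball x -> Mball y ->
      exists2 c, joins x y (ell (x, y)) c &
        forall l' c', joins x y l' c' ->
          l' = ell (x, y) /\ forall t, 0 <= t <= l' -> (c' t).1 = (c t).1.

Definition sq_time_lipschitz : Prop :=
  (forall z, SM z -> (tau_plus z < +oo)%E) /\
  [lipschitz travel_time z ^+ 2 | z in SM].

Definition simple_C11 : Prop :=
  [/\ C11_metric, index_coercive, uniquely_joined & sq_time_lipschitz].

(* Components of m-tensors in the global coordinates of the ball. *)
Definition tensor (m : nat) := {ffun 'I_m -> 'I_n} -> R.

Definition symmetric_tensor m (h : tensor m) : Prop :=
  forall (s : {perm 'I_m}) (J : {ffun 'I_m -> 'I_n}),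
    h [ffun a => J (s a)] = h J.

Definition symmetrize m (h : tensor m) : tensor m :=
  fun J : {ffun 'I_m -> 'I_n} =>
    (m`!)%:R^-1 * \sum_(s : {perm 'I_m}) h [ffun a => J (s a)].

Definition symmetric_field m (f : V -> tensor m) : Prop :=
  forall x, Mball x -> symmetric_tensor (f x).

Definition C11_field m (f : V -> tensor m) : Prop :=
  forall J, C11 (fun x => f x J).

(* (nabla p)_{k j_1 ... j_m}: the index of differentiation comes first. *)
Definition nabla m (p : V -> tensor m) (x : V) : tensor m.+1 :=
  fun J : {ffun 'I_m.+1 -> 'I_n} => let k := J ord0 in
  let J' := [ffun a : 'I_m => J (lift ord0 a)] in
  pderiv k (fun y => p y J') x
  - \sum_(a < m) \sum_l christoffel l k (J' a) x *
      p x [ffun b => if b == a then l else J' b].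

Definition eval_field m (f : V -> tensor m) (z : TM) : R :=
  \sum_(J : {ffun 'I_m -> 'I_n}) f z.1 J * \prod_a z.2 0 (J a).

Definition integral_fun m (f : V -> tensor m) (z : TM) : R :=
  \int[lebesgue_measure]_(t in `[0, travel_time z]) eval_field f (flow z t).

Definition xray_vanishes m (f : V -> tensor m) : Prop :=
  forall z, bdinSM z -> integral_fun f z = 0.

End Metric.

(* Main.v *)
(** If f vanishes on all vectors tangent to the sphere, then on the sphere the
    form of f is divisible by the linear form x . v, with a quotient q that is
    polynomial in x and f; p = (|x|^2 - 1) / 2 * sigma q works, since the first
    factor vanishes on the sphere and has differential x . v there.

    Vanishing on tangent vectors: along a geodesic, the second derivative of
    |x|^2 - 1 is twice a quadratic expression S(x, v) in the velocity. Any
    tangent vector (x, v) is a limit of initial velocities of geodesic chords of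
    length tending to 0, obtained by joining x to nearby points of the sphere.
    If S(x, v) > 0, such chords start strictly inward, every geodesic with that
    initial velocity leaves the ball after a short time, and the vanishing of
    the integral forces f(x, v) = 0 in the limit. The vectors with S > 0 are
    dense among the tangent ones: if S <= 0 on tangent vectors near (x, v), then
    b = |x|^2 - 1 satisfies b'' <= C (|b| + |b'|) along short chords, and the
    maximum principle contradicts b < 0 inside the chord. *)

Require Import Defs.
From mathcomp Require Import all_boot all_order all_algebra all_fingroup.
From mathcomp Require Import all_classical all_reals all_analysis.
From mathcomp Require Import ring lra.

Set Implicit Arguments.
Unset Strict Implicit.
Unset Printing Implicit Defensive.

Import Order.TTheory GRing.Theory Num.Theory.
Import numFieldNormedType.Exports.

(** * Symmetric tensors and their forms *)

Section Tensors.
Local Open Scope ring_scope.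
Context (R : realType) (n : nat).
Local Notation V := 'rV[R]_n.

(** The Christoffel symbols are merely Lipschitz, so geodesics are controlled by a priori bounds,
    uniform over all geodesics on short intervals with bounded initial velocity, rather than by
    smooth dependence on initial data. Chords exist because points can be joined, and they are short
    because the length function is continuous and vanishes on the diagonal. A chord is given by its
    end points, whereas its initial velocity w has to be close to a prescribed v. The displacement
    of the chord is l w up to O(l^2); with the end point on the great circle in direction v it is
    also a multiple of v up to a small relative error. Since v and w are unit vectors for the same
    inner product, the scalar factor is forced to be near 1 and w near v. In the density argument,
    the sign of S is known only at tangent vectors, but the chord runs off the sphere in other
    directions. A tangent vector at distance at most |b| + |b'| exists, and since S is Lipschitz
    this gives the differential inequality. *)

Definition tensor_form m (h : tensor R n m) (v : V) : R :=
  \sum_J h J * \prod_a v 0 (J a).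

Definition cons_index m (k : 'I_n) (J : {ffun 'I_m -> 'I_n}) :
    {ffun 'I_m.+1 -> 'I_n} :=
  [ffun a => oapp J k (unlift ord0 a)].

Definition tail_index m (J : {ffun 'I_m.+1 -> 'I_n}) : {ffun 'I_m -> 'I_n} :=
  [ffun a => J (lift ord0 a)].

Definition contract m (h : tensor R n m.+1) (k : 'I_n) : tensor R n m :=
  fun J => h (cons_index k J).

Lemma cons_index0 m k (J : {ffun 'I_m -> 'I_n}) : cons_index k J ord0 = k.
Proof. by rewrite ffunE unlift_none. Qed.

Lemma cons_index_lift m k (J : {ffun 'I_m -> 'I_n}) a :
  cons_index k J (lift ord0 a) = J a.
Proof. by rewrite ffunE liftK. Qed.

Lemma tail_cons_index m k (J : {ffun 'I_m -> 'I_n}) :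
  tail_index (cons_index k J) = J.
Proof. by apply/ffunP => a; rewrite ffunE cons_index_lift. Qed.

Lemma cons_index_tail m (J : {ffun 'I_m.+1 -> 'I_n}) :
  cons_index (J ord0) (tail_index J) = J.
Proof. by apply/ffunP => a; rewrite ffunE; case: unliftP => [b|] -> //=; rewrite ffunE. Qed.

Lemma sum_cons_index m (F : {ffun 'I_m.+1 -> 'I_n} -> R) :
  \sum_J F J = \sum_k \sum_J F (cons_index k J).
Proof.
rewrite pair_big /=.
rewrite (reindex (fun p : 'I_n * {ffun 'I_m -> 'I_n} => cons_index p.1 p.2)) //=.
exists (fun J : {ffun 'I_m.+1 -> 'I_n} => (J ord0, tail_index J)) => [[k J] _|J _] /=.
- by rewrite cons_index0 tail_cons_index.
- exact: cons_index_tail.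
Qed.

Lemma tensor_form_cons m (h : tensor R n m.+1) v :
  tensor_form h v = \sum_k v 0 k * tensor_form (contract h k) v.
Proof.
rewrite /tensor_form sum_cons_index; apply: eq_bigr => k _.
rewrite mulr_sumr; apply: eq_bigr => J _.
rewrite big_ord_recl cons_index0 /contract mulrCA; congr (_ * (_ * _)).
by apply: eq_bigr => a _; rewrite cons_index_lift.
Qed.

Lemma tensor_form_sum m (I : finType) (c : I -> R) (h : I -> tensor R n m) v :
  tensor_form (fun J => \sum_i c i * h i J) v = \sum_i c i * tensor_form (h i) v.
Proof.
rewrite /tensor_form; under [RHS]eq_bigr do rewrite mulr_sumr.
rewrite exchange_big; apply: eq_bigr => J _.
by rewrite mulr_suml; apply: eq_bigr => i _; rewrite mulrA.
Qed.

Lemma tensor_formD m (h1 h2 : tensor R n m) v :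
  tensor_form (fun J => h1 J + h2 J) v = tensor_form h1 v + tensor_form h2 v.
Proof. by rewrite /tensor_form -big_split; apply: eq_bigr => J _; rewrite mulrDl. Qed.

Lemma tensor_formB m (h1 h2 : tensor R n m) v :
  tensor_form (fun J => h1 J - h2 J) v = tensor_form h1 v - tensor_form h2 v.
Proof.
by rewrite /tensor_form -sumrB; apply: eq_bigr => J _; rewrite mulrBl.
Qed.

Lemma tensor_formZ m (h : tensor R n m) (a : R) v :
  tensor_form h (a *: v) = a ^+ m * tensor_form h v.
Proof.
rewrite /tensor_form mulr_sumr; apply: eq_bigr => J _.
rewrite mulrCA; congr (_ * _).
under eq_bigr do rewrite mxE.
by rewrite big_split prodr_const card_ord.
Qed.

Lemma tensor_form_symmetrize m (h : tensor R n m) v :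
  tensor_form (symmetrize h) v = tensor_form h v.
Proof.
have fact_neq0 : (m`!)%:R != 0 :> R by rewrite pnatr_eq0 -lt0n fact_gt0.
apply: (mulfI fact_neq0); rewrite /tensor_form mulr_sumr /symmetrize.
under eq_bigr do rewrite mulrA mulVKf // mulr_suml.
rewrite exchange_big /=.
have -> (x : R) : (m`!)%:R * x = \sum_(s : {perm 'I_m}) x.
  by rewrite sumr_const -(card_Sn m) mulr_natl; congr (_ *+ _); apply: eq_card.
apply: eq_bigr => s _.
rewrite [RHS](reindex (fun J : {ffun 'I_m -> 'I_n} => [ffun a => J (s a)])) /=.
  apply: eq_bigr => J _; congr (_ * _).
  rewrite (reindex_inj (@perm_inj _ s)).
  by apply: eq_bigr => a _; rewrite ffunE.
exists (fun J : {ffun 'I_m -> 'I_n} => [ffun a => J ((s^-1)%g a)]) => J _;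
  by apply/ffunP => a; rewrite !ffunE (permK, permKV).
Qed.

Lemma symmetrize_sym m (h : tensor R n m) : symmetric_tensor (symmetrize h).
Proof.
move=> s J; rewrite /symmetrize; congr (_ * _).
rewrite (reindex_inj (mulIg s^-1)%g) /=.
apply: eq_bigr => t _; congr h; apply/ffunP => a.
by rewrite !ffunE -permM -mulgA mulVg mulg1.
Qed.

Lemma contract_sym m (h : tensor R n m.+1) k :
  symmetric_tensor h -> symmetric_tensor (contract h k).
Proof.
move=> hs s J; rewrite /contract -[RHS](hs (lift_perm ord0 ord0 s)); congr h.
apply/ffunP => a; rewrite [RHS]ffunE.
case: (unliftP ord0 a) => [b ->|->].
- by rewrite lift_perm_lift !cons_index_lift ffunE.
- by rewrite lift_perm_id !cons_index0.
Qed.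

Lemma contract_swap m (h : tensor R n m.+2) j k : symmetric_tensor h ->
  contract (contract h j) k =1 contract (contract h k) j.
Proof.
move=> hs J; rewrite /contract -[LHS](hs (tperm ord0 (lift ord0 ord0))); congr h.
apply/ffunP => a; rewrite ffunE.
case: (unliftP ord0 a) => [b ->|->]; last by rewrite tpermL cons_index_lift !cons_index0.
case: (unliftP ord0 b) => [b' ->|->].
  by rewrite tpermD ?cons_index_lift // (inj_eq (@lift_inj _ ord0)).
by rewrite tpermR cons_index_lift !cons_index0.
Qed.

(** Induction on the order, expanding each contraction. Symmetry enters through [contract_swap],
    which turns the iterated contractions back into a single contraction with w. The remainder is
    kept as a polynomial so that roots can be counted in the polarization argument. *)
Lemma tensor_form_expand m (h : tensor R n m.+1) (v w : V) : symmetric_tensor h ->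
  exists p : {poly R}, forall t,
    tensor_form h (v + t *: w) = tensor_form h v
      + t * (m.+1%:R * \sum_k w 0 k * tensor_form (contract h k) v)
      + t ^+ 2 * p.[t].
Proof.
elim: m h => [|m IH] h hs.
  exists 0 => t; rewrite horner0 mulr0 addr0 mul1r !tensor_form_cons.
  have cst k u : tensor_form (contract h k) u = tensor_form (contract h k) v.
    by rewrite /tensor_form; apply: eq_bigr => J _; rewrite !big_ord0.
  under eq_bigr do rewrite cst mxE mxE mulrDl -mulrA.
  by rewrite big_split -mulr_sumr.
have /(_ _)/cid-/all_sig[p pP] := fun k => IH _ (contract_sym k hs).
pose D k := \sum_j w 0 j * tensor_form (contract (contract h k) j) v.
exists (\sum_k (w 0 k * (m.+1%:R * D k))%:P
   + \sum_k ((v 0 k)%:P + (w 0 k)%:P * 'X) * p k) => t.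
rewrite hornerD !horner_sum tensor_form_cons.
under eq_bigr do rewrite pP.
have -> : tensor_form h v = \sum_k v 0 k * tensor_form (contract h k) v.
  exact: tensor_form_cons.
have vD : \sum_k v 0 k * D k = \sum_k w 0 k * tensor_form (contract h k) v.
  under [RHS]eq_bigr do rewrite tensor_form_cons mulr_sumr.
  rewrite exchange_big /=; apply: eq_bigr => k _; rewrite mulr_sumr.
  apply: eq_bigr => j _; rewrite mulrCA; congr (_ * (_ * _)).
  by apply: eq_bigr => J _; rewrite contract_swap.
have -> : m.+2%:R * \sum_k w 0 k * tensor_form (contract h k) v =
   \sum_k w 0 k * tensor_form (contract h k) v + m.+1%:R * \sum_k v 0 k * D k.
  by rewrite vD -natr1; ring.
rewrite mulr_sumr !mulrDr !mulr_sumr -!big_split /=.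
apply: eq_bigr => k _.
by rewrite !mxE hornerM hornerD hornerM hornerX !hornerC -/(D k); ring.
Qed.

(** Polarization: the derivative of the form in the direction of a basis vector is m+1 times the
    form of the corresponding contraction, so the contractions also have zero forms and induction
    applies. *)
Lemma symmetric_tensor_eq0 m (h : tensor R n m) : symmetric_tensor h ->
  (forall v, tensor_form h v = 0) -> forall J, h J = 0.
Proof.
elim: m h => [|m IH] h hs h0 J.
  have := h0 0; rewrite /tensor_form (bigD1 J) //= big_ord0 mulr1 big1 ?addr0 //.
  by move=> K /eqP[]; apply/ffunP => -[].
rewrite -(cons_index_tail J).
apply: (IH _ (contract_sym (J ord0) hs)) => v.
have [p pP] := tensor_form_expand v (delta_mx 0 (J ord0)) hs.
set d := \sum_k _ in pP.
have dE : d = tensor_form (contract h (J ord0)) v.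
  rewrite /d (bigD1 (J ord0)) //= mxE !eqxx mul1r big1 ?addr0 // => k /negPf kJ.
  by rewrite mxE kJ andbF mul0r.
rewrite -dE; apply: (mulfI (_ : m.+1%:R != 0 :> R)); first by rewrite pnatr_eq0.
rewrite mulr0; move: pP; move: (_ * d) => {dE}d' pP; move: d' pP => {d}d pP.
pose q := d%:P + 'X * p.
suff q0 : q = 0.
  have : q.[0] = 0 by rewrite q0 horner0.
  by rewrite hornerD hornerC hornerM hornerX mul0r addr0.
(* Positive integers are roots of [q], and as many as [size q] of them are one too many for a
   nonzero polynomial. They are nonzero, so the factor t of the expansion can be cancelled. *)
pose rs := [seq i.+1%:R : R | i <- iota 0 (size q)].
apply/eqP; apply: contraT => q0.
have : (size rs < size q)%N.
  apply: max_poly_roots => //; last first.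
    rewrite map_inj_uniq ?iota_uniq // => i j /eqP.
    by rewrite eqr_nat eqSS => /eqP.
  apply/allP => _ /mapP[i _ ->]; apply/rootP.
  apply: (mulfI (_ : i.+1%:R != 0 :> R)); first by rewrite pnatr_eq0.
  have := pP i.+1%:R; rewrite !h0 add0r => /esym; rewrite mulr0 => <-.
  by rewrite hornerD hornerC hornerM hornerX; ring.
by rewrite size_map size_iota ltnn.
Qed.

Lemma symmetric_tensor_inj m (h1 h2 : tensor R n m) :
  symmetric_tensor h1 -> symmetric_tensor h2 ->
  tensor_form h1 =1 tensor_form h2 -> h1 =1 h2.
Proof.
move=> s1 s2 h12 J; apply/eqP; rewrite -subr_eq0; apply/eqP.
apply: (@symmetric_tensor_eq0 _ (fun J => h1 J - h2 J)) => [s K|v].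
  by rewrite s1 s2.
by rewrite tensor_formB h12 subrr.
Qed.

End Tensors.

(** * C11 functions on the ball *)

Section BoundedLipschitz.
Local Open Scope classical_set_scope.
Local Open Scope ring_scope.
Context (R : realType) (T : normedModType R).
Implicit Types (A : set T) (F G : T -> R).

(** Boundedness is included because Lipschitz functions alone are not closed under products; a
    single constant serves for both bounds. *)
Definition bounded_lipschitz A F := exists2 K : R, 0 <= K &
  (forall x, A x -> `|F x| <= K) /\
  (forall x y, A x -> A y -> `|F x - F y| <= K * `|x - y|).

Lemma bounded_lipschitz_eq A F G : (forall x, A x -> F x = G x) ->
  bounded_lipschitz A F -> bounded_lipschitz A G.
Proof.
move=> FG [K K0 [FK FL]]; exists K => //; split => [x Ax|x y Ax Ay].
  by rewrite -FG ?FK.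
by rewrite -!FG ?FL.
Qed.

Lemma bounded_lipschitz_cst A (a : R) : bounded_lipschitz A (fun=> a).
Proof.
exists `|a| => //; split => // x y _ _.
by rewrite subrr normr0 mulr_ge0.
Qed.

Lemma bounded_lipschitzD A F G : bounded_lipschitz A F ->
  bounded_lipschitz A G -> bounded_lipschitz A (fun x => F x + G x).
Proof.
move=> [K K0 [FK FL]] [K' K'0 [GK GL]].
exists (K + K'); first exact: addr_ge0.
split => [x Ax|x y Ax Ay].
  by rewrite (le_trans (ler_normD _ _)) // lerD ?FK ?GK.
rewrite mulrDl opprD addrACA (le_trans (ler_normD _ _)) //.
by rewrite lerD ?FL ?GL.
Qed.

Lemma bounded_lipschitzM A F G : bounded_lipschitz A F ->
  bounded_lipschitz A G -> bounded_lipschitz A (fun x => F x * G x).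
Proof.
move=> [K K0 [FK FL]] [K' K'0 [GK GL]].
exists (2 * K * K'); first by rewrite !mulr_ge0.
split => [x Ax|x y Ax Ay].
  rewrite normrM (le_trans (ler_pM _ _ (FK _ Ax) (GK _ Ax))) //.
  by rewrite -mulrA ler_peMl ?mulr_ge0 // ler1n.
have -> : F x * G x - F y * G y = F x * (G x - G y) + (F x - F y) * G y by ring.
rewrite (le_trans (ler_normD _ _)) // !normrM.
have := ler_pM (normr_ge0 _) (normr_ge0 _) (FK _ Ax) (GL _ _ Ax Ay).
have := ler_pM (normr_ge0 _) (normr_ge0 _) (FL _ _ Ax Ay) (GK _ Ay).
by move=> h1 h2; apply: (le_trans (lerD h2 h1)); rewrite le_eqVlt; apply/orP; left; apply/eqP; ring.
Qed.

Lemma bounded_lipschitzN A F :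
  bounded_lipschitz A F -> bounded_lipschitz A (fun x => - F x).
Proof.
move=> FL; apply: bounded_lipschitz_eq (bounded_lipschitzM (bounded_lipschitz_cst A (-1)) FL).
by move=> x _; rewrite mulN1r.
Qed.

Lemma bounded_lipschitzB A F G : bounded_lipschitz A F ->
  bounded_lipschitz A G -> bounded_lipschitz A (fun x => F x - G x).
Proof. by move=> FL /bounded_lipschitzN; exact: bounded_lipschitzD. Qed.

Lemma bounded_lipschitz_sum A (I : Type) (r : seq I) (F : I -> T -> R) :
  (forall i, bounded_lipschitz A (F i)) ->
  bounded_lipschitz A (fun x => \sum_(i <- r) F i x).
Proof.
move=> FL; elim: r => [|i r IH].
  by apply: bounded_lipschitz_eq (bounded_lipschitz_cst A 0) => x _; rewrite big_nil.
apply: bounded_lipschitz_eq (bounded_lipschitzD (FL i) IH) => x _.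
by rewrite big_cons.
Qed.

Lemma bounded_lipschitz_prod A (I : Type) (r : seq I) (F : I -> T -> R) :
  (forall i, bounded_lipschitz A (F i)) ->
  bounded_lipschitz A (fun x => \prod_(i <- r) F i x).
Proof.
move=> FL; elim: r => [|i r IH].
  by apply: bounded_lipschitz_eq (bounded_lipschitz_cst A 1) => x _; rewrite big_nil.
apply: bounded_lipschitz_eq (bounded_lipschitzM (FL i) IH) => x _.
by rewrite big_cons.
Qed.

Lemma bounded_lipschitzV A F (d : R) : 0 < d -> (forall x, A x -> d <= `|F x|) ->
  bounded_lipschitz A F -> bounded_lipschitz A (fun x => (F x)^-1).
Proof.
move=> d0 dF [K K0 [FK FL]].
have Vd x : A x -> `|(F x)^-1| <= d^-1.
  by move=> Ax; rewrite normfV lef_pV2 ?dF ?posrE // (lt_le_trans d0) ?dF.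
have d1 : 0 <= d^-1 by rewrite invr_ge0 ltW.
exists (d^-1 + d^-1 * d^-1 * K); first by rewrite addr_ge0 ?mulr_ge0.
split => [x Ax|x y Ax Ay].
  by rewrite (le_trans (Vd _ Ax)) // lerDl !mulr_ge0.
have F0 z : A z -> F z != 0.
  by move=> Az; rewrite -normr_gt0 (lt_le_trans d0) ?dF.
have -> : (F x)^-1 - (F y)^-1 = - ((F x)^-1 * (F y)^-1 * (F x - F y)).
  by field; rewrite !F0.
rewrite normrN !normrM mulrDl.
apply: le_trans (_ : d^-1 * d^-1 * (K * `|x - y|) <= _).
  by rewrite ler_pM ?mulr_ge0 ?FL // ler_pM ?Vd.
by rewrite mulrA lerDr mulr_ge0.
Qed.

Lemma bounded_lipschitz_lipschitz A F :
  bounded_lipschitz A F -> [lipschitz F x | x in A].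
Proof.
move=> [K K0 [_ FL]]; exists K; split; first exact: num_real.
move=> K' KK' [x y] [/= Ax Ay].
by rewrite (le_trans (FL _ _ Ax Ay)) // ler_wpM2r // ltW.
Qed.

Lemma bounded_lipschitzW A F (D K : R) :
  (forall x y, A x -> A y -> `|x - y| <= D) ->
  (forall x y, A x -> A y -> `|F x - F y| <= K * `|x - y|) ->
  bounded_lipschitz A F.
Proof.
move=> AD FL.
have [[a Aa]|A0] := pselect (A !=set0); last first.
  by exists 0 => //; split => [x Ax|x y Ax]; case: A0; exists x.
have D0 : 0 <= D by rewrite (le_trans _ (AD _ _ Aa Aa)).
exists (`|K| + (`|K| * D + `|F a|)); first by rewrite !addr_ge0 ?mulr_ge0.
split => [x Ax|x y Ax Ay]; last first.
  rewrite (le_trans (FL _ _ Ax Ay)) // ler_wpM2r //.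
  by rewrite ler_wpDr ?ler_norm // addr_ge0 ?mulr_ge0.
rewrite -(subrK (F a) (F x)) (le_trans (ler_normD _ _)) // addrA lerD2r.
rewrite (le_trans (FL _ _ Ax Aa)) // ler_wpDl //.
by rewrite (@le_trans _ _ (`|K| * `|x - a|)) ?ler_wpM2r ?ler_norm // ler_wpM2l ?AD.
Qed.

Lemma lipschitz_bounded_lipschitz A F (D : R) :
  (forall x y, A x -> A y -> `|x - y| <= D) ->
  [lipschitz F x | x in A] -> bounded_lipschitz A F.
Proof.
move=> AD [K0 [_ FL0]].
apply: (@bounded_lipschitzW _ _ _ (`|K0| + 1) AD) => x y Ax Ay.
apply: (FL0 _ _ (x, y)) => //.
by rewrite (le_lt_trans (ler_norm _)) // ltrDl.
Qed.

End BoundedLipschitz.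

Section C11Functions.
Local Open Scope classical_set_scope.
Local Open Scope ring_scope.
Context (R : realType) (n : nat).
Local Notation V := 'rV[R]_n.

Lemma coord_le_norm (x : V) i : `|x 0 i| <= `|x|.
Proof.
by rewrite [leRHS]/Num.Def.normr/= mx_normrE; exact: (le_bigmax _ (fun ij => `|x ij.1 ij.2|) (0, i)).
Qed.

Lemma norm_le_coord (x : V) (e : R) : 0 <= e -> (forall i, `|x 0 i| <= e) -> `|x| <= e.
Proof.
move=> e0 xe; rewrite [leLHS]/Num.Def.normr/= mx_normrE bigmax_le //= => -[i j] _ /=.
by rewrite ord1 xe.
Qed.

Lemma Mball_norm (x : V) : Mball x -> `|x| <= 1.
Proof.
move=> /= x1; apply: norm_le_coord => // i.
rewrite -(@ler_pXn2r _ 2) ?nnegrE // expr1n real_normK ?num_real //.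
by rewrite (le_trans _ x1) // /sqnorm (bigD1 i) //= lerDl sumr_ge0 // => j _; rewrite sqr_ge0.
Qed.

Lemma Mball_dist (x y : V) : Mball x -> Mball y -> `|x - y| <= 2.
Proof.
move=> /Mball_norm x1 /Mball_norm y1.
by rewrite (le_trans (ler_normB _ _)) // -[2]/(1 + 1) lerD.
Qed.

Lemma Mball_segment (x y : V) t : Mball x -> Mball y -> 0 <= t <= 1 ->
  Mball (x + t *: (y - x)).
Proof.
rewrite /Mball /= => x1 y1 /andP[t0 t1].
have -> : 1 = (1 - t) * 1 + t * 1 :> R by ring.
rewrite (@le_trans _ _ ((1 - t) * sqnorm x + t * sqnorm y)) //; last first.
  by rewrite lerD // ler_wpM2l // subr_ge0.
rewrite /sqnorm !mulr_sumr -big_split ler_sum // => i _; rewrite !mxE /=.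
rewrite -subr_ge0; set a := x 0 i; set b := y 0 i.
have -> : (1 - t) * a ^+ 2 + t * b ^+ 2 - (a + t * (b - a)) ^+ 2
   = t * ((1 - t) * (b - a) ^+ 2) by ring.
apply: mulr_ge0 => //; apply: mulr_ge0; first by rewrite subr_ge0.
exact: sqr_ge0.
Qed.

Lemma derive_pderiv (F : V -> R) x v : differentiable F x ->
  'D_v F x = \sum_k v 0 k * pderiv k F x.
Proof.
move=> dF; rewrite deriveE // {1}(row_sum_delta v) linear_sum.
by apply: eq_bigr => k _; rewrite linearZ /pderiv deriveE.
Qed.

Lemma is_derive_line (F : V -> R) (x v : V) (t : R) :
  derivable F (x + t *: v) v ->
  is_derive t 1 (fun s => F (x + s *: v)) ('D_v F (x + t *: v)).
Proof.
move=> dF.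
have E : (fun h : R => h^-1 *: (((fun s => F (x + s *: v)) \o shift t) (h *: (1 : R)) - F (x + t *: v)))
   = (fun h : R => h^-1 *: ((F \o shift (x + t *: v)) (h *: v) - F (x + t *: v))).
  apply/funext => h /=; congr (_ *: (F _ - _)).
  by rewrite [h *: 1]mulr1 scalerDl addrCA.
by apply: DeriveDef; rewrite /derivable /derive E.
Qed.

(** The partial derivatives are Lipschitz on a bounded set, hence bounded; the mean value theorem on
    segments, which stay in the convex ball, then bounds the increments of F. *)
Lemma C11_bounded_lipschitz (F : V -> R) : C11 F -> bounded_lipschitz (@Mball R n) F.
Proof.
move=> [dF lF].
have /(_ _)/cid2-/all_sig2[K K0 KF] := fun k => lipschitz_bounded_lipschitz Mball_dist (lF k).
apply: (bounded_lipschitzW (K := \sum_k K k) Mball_dist) => x y Bx By.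
have der (t : R) : 0 <= t <= 1 ->
    is_derive t 1 (fun s : R => F (y + s *: (x - y)))
      ('D_(x - y) F (y + t *: (x - y))).
  by move=> t01; apply/is_derive_line/diff_derivable/dF/Mball_segment.
have [t t01||t t01] := @MVT_segment R (fun s => F (y + s *: (x - y)))
   (fun s => 'D_(x - y) F (y + s *: (x - y))) 0 1 ler01.
- by apply: der; rewrite ?ltW ?(itvP t01).
- apply: derivable_within_continuous => t t01.
  by apply: (@ex_derive _ _ _ _ _ _ _ (der t _)); rewrite !(itvP t01).
rewrite scale1r scale0r addr0 [y + (x - y)]addrC subrK subr0 mulr1 => ->.
rewrite derive_pderiv; last by apply/dF/Mball_segment; rewrite ?(itvP t01).
rewrite (le_trans (ler_norm_sum _ _ _)) // mulr_suml ler_sum // => k _.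
rewrite normrM mulrC ler_pM //.
  by case: (KF k) => + _; apply; apply: Mball_segment; rewrite ?(itvP t01).
by rewrite (le_trans _ (coord_le_norm _ k)).
Qed.
Lemma C11_pderiv_bounded_lipschitz (F : V -> R) k :
  C11 F -> bounded_lipschitz (@Mball R n) (pderiv k F).
Proof. by move=> [_ /(_ k)]; exact: (lipschitz_bounded_lipschitz Mball_dist). Qed.

Lemma C11_intro (F : V -> R) :
  (forall x, Mball x -> differentiable F x) ->
  (forall k, bounded_lipschitz (@Mball R n) (pderiv k F)) -> C11 F.
Proof.
by move=> dF lF; split => // k; exact: bounded_lipschitz_lipschitz (lF k).
Qed.

Lemma C11_cst (a : R) : C11 (fun _ : V => a).
Proof.
apply: C11_intro => [x _|k]; first exact: differentiable_cst.
apply: bounded_lipschitz_eq (bounded_lipschitz_cst _ 0) => x _.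
by rewrite /pderiv derive_cst.
Qed.

Lemma pderiv_coord (i k : 'I_n) (x : V) :
  pderiv k (fun y : V => y 0 i) x = (i == k)%:R.
Proof.
rewrite /pderiv /derive; apply/cvg_lim => //.
apply: cvg_near_cst; near=> h => /=.
rewrite !mxE eqxx /= addrK /GRing.scale /= mulKf //.
by near: h; exact: nbhs_dnbhs_neq.
Unshelve. all: by end_near. Qed.

Lemma C11_coord (i : 'I_n) : C11 (fun x : V => x 0 i).
Proof.
apply: C11_intro => [x _|k]; first exact: differentiable_coord.
apply: bounded_lipschitz_eq (bounded_lipschitz_cst _ ((i == k)%:R)) => x _.
by rewrite pderiv_coord.
Qed.

Lemma C11D (F G : V -> R) : C11 F -> C11 G -> C11 (fun x => F x + G x).
Proof.
move=> cF cG; have [[dF _] [dG _]] := (cF, cG).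
apply: C11_intro => [x Bx|k]; first exact: differentiableD (dF x Bx) (dG x Bx).
apply: (bounded_lipschitz_eq _ (bounded_lipschitzD
  (C11_pderiv_bounded_lipschitz k cF) (C11_pderiv_bounded_lipschitz k cG))) => x Bx.
by apply/esym/deriveD; apply/diff_derivable; [exact: dF|exact: dG].
Qed.

Lemma pderivM (F G : V -> R) k x : differentiable F x -> differentiable G x ->
  pderiv k (fun y => F y * G y) x = F x * pderiv k G x + G x * pderiv k F x.
Proof.
by move=> dF dG; rewrite /pderiv -[LHS]/('D_ _ (F * G) x) deriveM //; exact: diff_derivable.
Qed.

Lemma C11M (F G : V -> R) : C11 F -> C11 G -> C11 (fun x => F x * G x).
Proof.
move=> cF cG; have [[dF _] [dG _]] := (cF, cG).
apply: C11_intro => [x Bx|k]; first exact: differentiableM (dF x Bx) (dG x Bx).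
apply: (bounded_lipschitz_eq _ (bounded_lipschitzD
  (bounded_lipschitzM (C11_bounded_lipschitz cF) (C11_pderiv_bounded_lipschitz k cG))
  (bounded_lipschitzM (C11_bounded_lipschitz cG) (C11_pderiv_bounded_lipschitz k cF)))) => x Bx.
by rewrite pderivM //; [exact: dF|exact: dG].
Qed.

Lemma C11_eq (F G : V -> R) : F =1 G -> C11 F -> C11 G.
Proof. by move=> /funext ->. Qed.

Lemma C11B (F G : V -> R) : C11 F -> C11 G -> C11 (fun x => F x - G x).
Proof.
move=> cF cG; apply: (C11_eq _ (C11D cF (C11M (C11_cst (-1)) cG))) => x.
by rewrite mulN1r.
Qed.

Lemma C11_sum (I : Type) (r : seq I) (F : I -> V -> R) :
  (forall i, C11 (F i)) -> C11 (fun x => \sum_(i <- r) F i x).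
Proof.
move=> cF; elim: r => [|i r IH].
  by apply: (C11_eq _ (C11_cst 0)) => x; rewrite big_nil.
by apply: (C11_eq _ (C11D (cF i) IH)) => x; rewrite big_cons.
Qed.

End C11Functions.

(** * Division by the linear form x . v and the potential near the sphere *)

Section Division.
Local Open Scope ring_scope.
Context (R : realType) (n : nat).
Local Notation V := 'rV[R]_n.

Definition dotp (x v : V) : R := \sum_i x 0 i * v 0 i.

(** On the sphere this is the orthogonal projection of v onto the tangent space. Leaving out the
    division by |x|^2 keeps it polynomial in x on the whole ball. *)
Definition tangent_part (x v : V) : V := v - dotp x v *: x.

(** Exact division over the whole ball, not only on the sphere: replacing one argument v by its
    tangent part costs a multiple of x . v, and induction handles the other arguments. Only products
    and sums of coordinates and components occur, so the quotient is again C11. *)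
Lemma tensor_form_tangent_part m (f : V -> tensor R n m.+1) : C11_field f ->
  exists2 q : V -> tensor R n m, C11_field q & forall x v,
    tensor_form (f x) v - tensor_form (f x) (tangent_part x v) =
    dotp x v * tensor_form (q x) v.
Proof.
elim: m f => [|m IH] f cf.
  exists (fun (x : V) J => \sum_k x 0 k * contract (f x) k J).
    by move=> J; apply: C11_sum => k; apply: C11M; [exact: C11_coord|exact: cf].
  move=> x v; rewrite tensor_form_sum !tensor_form_cons -sumrB mulr_sumr.
  apply: eq_bigr => k _; rewrite mulrA.
  have -> : tensor_form (contract (f x) k) (tangent_part x v)
      = tensor_form (contract (f x) k) v.
    by apply: eq_bigr => J _; rewrite !big_ord0.
  by rewrite -mulrBl !mxE; congr (_ * _); ring.
have cfk k : C11_field (fun x => contract (f x) k) by move=> J; exact: cf.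
have /(_ _)/cid2-/all_sig2[q cq qE] := fun k => IH _ (cfk k).
(* The first sum is the cost of replacing the first argument, namely f contracted with x. The rest
   applies the tangent projection, transposed to the first index, to the quotients [q k] of the
   contractions. *)
exists (fun (x : V) (J : {ffun 'I_m.+1 -> 'I_n}) => \sum_k x 0 k * contract (f x) k J
  + (q (J ord0) x (tail_index J)
     - x 0 (J ord0) * \sum_k x 0 k * q k x (tail_index J))).
  move=> J; apply: C11D.
    by apply: C11_sum => k; apply: C11M; [exact: C11_coord|exact: cf].
  apply: C11B; first exact: cq.
  apply: C11M; first exact: C11_coord.
  by apply: C11_sum => k; apply: C11M; [exact: C11_coord|exact: cq].
move=> x v; rewrite tensor_formD tensor_form_sum.
set T := fun k => tensor_form (q k x) v.
have -> : tensor_form (fun J : {ffun 'I_m.+1 -> 'I_n} => q (J ord0) x (tail_index J)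
     - x 0 (J ord0) * \sum_k x 0 k * q k x (tail_index J)) v =
    \sum_k v 0 k * (T k - x 0 k * \sum_j x 0 j * T j).
  rewrite tensor_form_cons; apply: eq_bigr => k _; congr (_ * _).
  transitivity (tensor_form (fun J => q k x J
      - \sum_j (x 0 k * x 0 j) * q j x J) v).
    apply: eq_bigr => J _; rewrite /contract cons_index0 tail_cons_index.
    by rewrite mulr_sumr; congr ((_ - _) * _); apply: eq_bigr => j _; rewrite mulrA.
  rewrite tensor_formB !tensor_form_sum; congr (_ - _).
  by rewrite mulr_sumr; apply: eq_bigr => j _; rewrite mulrA.
rewrite !(tensor_form_cons (f x)) -sumrB.
have -> : \sum_k v 0 k * (T k - x 0 k * \sum_j x 0 j * T j) =
    \sum_k (v 0 k - dotp x v * x 0 k) * T k.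
  transitivity (\sum_k v 0 k * T k - dotp x v * \sum_j x 0 j * T j).
    rewrite {1}/dotp mulr_suml -sumrB; apply: eq_bigr => k _; ring.
  by rewrite mulr_sumr -sumrB; apply: eq_bigr => k _; ring.
rewrite -big_split mulr_sumr; apply: eq_bigr => k _ /=.
have <- := subKr (tensor_form (contract (f x) k) v)
                 (tensor_form (contract (f x) k) (tangent_part x v)).
by rewrite qE !mxE -/(T k); ring.
Qed.

End Division.

Section BoundaryPotential.
Local Open Scope classical_set_scope.
Local Open Scope ring_scope.
Context (R : realType) (n : nat).
Local Notation V := 'rV[R]_n.

(* [half_defect] vanishes on the sphere, where its differential is [v |-> x . v]. *)
Definition half_defect (x : V) : R := 2^-1 * (sqnorm x - 1).

Lemma C11_sqnorm : C11 (@sqnorm R n).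
Proof.
by apply: C11_sum => i; rewrite /GRing.exp /=; apply: C11M; exact: C11_coord.
Qed.

Lemma C11_half_defect : C11 half_defect.
Proof. by apply: C11M; [exact: C11_cst|apply: C11B; [exact: C11_sqnorm|exact: C11_cst]]. Qed.

Lemma pderiv_half_defect k (x : V) : pderiv k half_defect x = x 0 k.
Proof.
have dc (i : 'I_n) : is_derive x (delta_mx 0 k : V) (fun y : V => y 0 i) (i == k)%:R.
  rewrite -(pderiv_coord i k x); apply: derivableP.
  exact/diff_derivable/differentiable_coord.
have ds : is_derive x (delta_mx 0 k : V) (\sum_i (fun y : V => y 0 i) ^+ 2)
    (\sum_i (2%:R * x 0 i ^+ 1) *: ((i == k)%:R : R)).
  by apply: is_derive_sum => i; exact: (is_deriveX 2).
rewrite /pderiv (_ : half_defect =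
   2^-1 *: (\sum_i (fun y : V => y 0 i) ^+ 2 - cst 1)); last first.
  by apply/funext => y; rewrite /half_defect /= -[RHS]/(2^-1 * ((\sum_i (fun y : V => y 0 i) ^+ 2) y - 1)) fct_sumE.
rewrite derive_val subr0 (bigD1 k) //= eqxx big1 => [|i /negPf ->]; last by rewrite scaler0.
by rewrite addr0 /GRing.scale /= expr1; field.
Qed.

(** Both tensors being symmetric, it is enough to compare their forms. In the covariant derivative
    of p, the Christoffel terms and the derivative of the quotient carry the factor [half_defect],
    so on the sphere only x . v times the form of the quotient remains. *)
Lemma boundary_potential (g : V -> 'M[R]_n) m (f : V -> tensor R n m.+1) :
  symmetric_field f -> C11_field f ->
  (forall x v, Mbd x -> dotp x v = 0 -> tensor_form (f x) v = 0) ->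
  exists p : V -> tensor R n m,
    [/\ symmetric_field p, C11_field p,
        (forall x, Mbd x -> forall J, f x J = symmetrize (nabla g p x) J) &
        (forall x, Mbd x -> forall J, p x J = 0)].
Proof.
move=> fs fc f0; have [q qc qE] := tensor_form_tangent_part fc.
have sqc J : C11 (fun x => symmetrize (q x) J).
  apply: C11M; first exact: C11_cst.
  by apply: C11_sum => s; exact: qc.
have r0 x : Mbd x -> half_defect x = 0.
  by rewrite /half_defect => ->; rewrite subrr mulr0.
exists (fun x J => half_defect x * symmetrize (q x) J).
split => [x _ s J|J|x bx|x bx J].
- by rewrite symmetrize_sym.
- by apply: C11M; [exact: C11_half_defect|exact: sqc].
- have Bx : Mball x by rewrite /Mball /= bx.
  apply: symmetric_tensor_inj; [exact: fs|exact: symmetrize_sym|] => v.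
  have tv : dotp x (tangent_part x v) = 0.
    have : dotp x x = 1 by rewrite -[RHS]bx; apply: eq_bigr => i _; rewrite -expr2.
    rewrite /dotp; under [in X in _ -> X]eq_bigr do rewrite !mxE mulrBr mulrCA.
    by rewrite sumrB -mulr_sumr => ->; rewrite mulr1 subrr.
  have := qE x v; rewrite (f0 _ _ bx tv) subr0 tensor_form_symmetrize => ->.
  rewrite tensor_form_cons /dotp mulr_suml; apply: eq_bigr => k _.
  rewrite -(tensor_form_symmetrize (q x)) -mulrA mulrCA; congr (_ * _).
  rewrite /tensor_form mulr_sumr; apply: eq_bigr => J _; rewrite mulrA; congr (_ * _).
  rewrite /contract /nabla cons_index0 -/(tail_index _) tail_cons_index.
  rewrite pderivM; [|by case: C11_half_defect => + _; exact|by case: (sqc J) => + _; exact].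
  rewrite pderiv_half_defect (r0 _ bx) mul0r add0r mulrC.
  rewrite big1 ?subr0 // => a _; rewrite big1 // => l _.
  by rewrite mul0r mulr0.
- by rewrite (r0 _ bx) mul0r.
Qed.

End BoundaryPotential.

(** * Functions of one variable *)

Section OneVariable.
Local Open Scope classical_set_scope.
Local Open Scope ring_scope.
Context (R : realType).
Implicit Types (b d e : R -> R) (T : R).

(** The bound on the derivative is required only before t, so M may itself depend on t; with M
    proportional to t this gives quadratic estimates. *)
Lemma derivative_bound b d T (M t : R) : {within `[0, T], continuous b} ->
  (forall s, 0 < s < T -> is_derive s 1 b (d s)) ->
  (forall s, 0 < s < T -> s < t -> `|d s| <= M) ->
  0 <= t <= T -> `|b t - b 0| <= M * t.
Proof.
move=> cb db dM /andP[]; rewrite le_eqVlt => /predU1P[<- _|t0 tT].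
  by rewrite subrr normr0 mulr0.
have h s : s \in `]0, t[%R -> 0 < s < T.
  by rewrite in_itv /= => /andP[-> st] /=; exact: lt_le_trans tT.
have [s st ->] := MVT t0 (fun s st => db s (h s st))
  (continuous_subspaceW (subset_itvl (a := BLeft 0) (tT : (BRight t <= BRight T)%O)) cb).
rewrite subr0 normrM (gtr0_norm t0) ler_wpM2r ?(ltW t0) // dM ?h //.
by rewrite (itvP st).
Qed.

(** Two applications of the mean value theorem: the bound on e makes d grow at least linearly, and
    then b minus the quadratic polynomial does not decrease. *)
Lemma taylor2_lower b d e T s : 0 <= T ->
  {within `[0, T], continuous b} -> {within `[0, T], continuous d} ->
  (forall t, 0 < t < T -> is_derive t 1 b (d t)) ->
  (forall t, 0 < t < T -> is_derive t 1 d (e t)) ->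
  (forall t, 0 < t < T -> s <= e t) ->
  b 0 + d 0 * T + 2^-1 * s * T ^+ 2 <= b T.
Proof.
move=> T0 cb cd db dd se.
have dge t : 0 < t < T -> d 0 + s * t <= d t.
  move=> /andP[t0 tT].
  have [|| x x0t E] := @MVT R d e 0 t t0.
  - by move=> x /[!in_itv]/= /andP[x0 xt]; apply: dd; rewrite x0 (lt_trans xt).
  - by apply: continuous_subspaceW cd; apply: subset_itvl; rewrite bnd_simp ltW.
  rewrite addrC -lerBrDr E subr0; apply: ler_wpM2r; first exact: ltW.
  by apply: se; rewrite (itvP x0t) (lt_trans _ tT) // (itvP x0t).
pose h t := b t - d 0 * t - 2^-1 * s * t ^+ 2.
have dh t : 0 < t < T -> is_derive t 1 h (d t - d 0 - s * t).
  move=> tT; have := db _ tT => dbt.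
  rewrite (_ : h = b - d 0 *: id - (2^-1 * s) *: (id ^+ 2)) //.
  by apply: is_derive_eq; rewrite /GRing.scale /= expr1; field.
have ch : {within `[0, T], continuous h}.
  have cg : continuous (fun t : R => d 0 * t + 2^-1 * s * t ^+ 2).
    move=> u; apply: cvgD; apply: cvgM; first exact: cvg_cst.
    - exact: cvg_id.
    - exact: cvg_cst.
    - exact: exprn_continuous.
  rewrite (_ : h = fun t => b t - (d 0 * t + 2^-1 * s * t ^+ 2)); last first.
    by apply/funext => t; rewrite opprD addrA.
  apply/subspace_continuousP => u uT; apply: cvgB.
    exact: (subspace_continuousP _ b).1 cb u uT.
  exact: (subspace_continuousP _ _).1 (continuous_subspaceT cg) u uT.
move: T0; rewrite le_eqVlt => /predU1P[<-|T0].
  by rewrite expr0n !mulr0 !addr0.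
have dh' x : x \in `]0, T[%R -> is_derive x 1 h (d x - d 0 - s * x).
  by move=> x0T; apply: dh; rewrite !(itvP x0T).
have [x x0T E] := MVT T0 dh' ch.
rewrite -subr_ge0 (_ : _ - _ = h T - h 0); last by rewrite /h; ring.
rewrite E; apply: mulr_ge0; last by rewrite subr0 ltW.
by rewrite -addrA -opprD subr_ge0 dge // !(itvP x0T).
Qed.

(* If [b / (1 - C t ^ 2)] has minimum [m < 0], then [b - m (1 - C t ^ 2)] has
   minimum 0 but a negative second derivative there. *)
Lemma short_maximum_principle (C T : R) b d e : 0 < T -> 1 <= C -> 2 * C * T < 1 ->
  {within `[0, T], continuous b} ->
  (forall t, 0 < t < T -> is_derive t 1 b (d t)) ->
  (forall t, 0 < t < T -> is_derive t 1 d (e t)) ->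
  b 0 = 0 -> b T = 0 -> (forall t, 0 < t < T -> b t < 0) ->
  (forall t, 0 < t < T -> e t <= C * (- b t + `|d t|)) -> False.
Proof.
move=> T0 C1 CT cb db dd b0 bT bneg eC.
pose phi (t : R) := 1 - C * t ^+ 2.
have C0 : 0 < C by lra.
have phi0 t : 0 <= t <= T -> 0 < phi t.
  move=> /andP[t0 tT]; rewrite /phi subr_gt0.
  have CT1 : C * T < 1 by nra.
  have t1 : t < 1 by nra.
  by have : C * t ^+ 2 < 1 by rewrite expr2; nra.
have cphi : continuous phi.
  move=> t; apply: cvgB; first exact: cvg_cst.
  by apply: cvgM; [exact: cvg_cst|exact: exprn_continuous].
have ch : {within `[0, T], continuous (fun t => b t / phi t)}.
  apply/subspace_continuousP => t tT; apply: cvgM.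
    exact: (subspace_continuousP _ b).1 cb t tT.
  apply: cvgV; first by rewrite gt_eqF // phi0 // !(itvP tT).
  exact: (subspace_continuousP _ phi).1 (continuous_subspaceT cphi) t tT.
have [c c0T hmin] := EVT_min (ltW T0) ch.
pose m := b c / phi c.
have T2 : 0 < T / 2 < T by lra.
have m0 : m < 0.
  apply: (@le_lt_trans _ _ (b (T / 2) / phi (T / 2))).
      by apply: hmin; rewrite in_itv /=; lra.
  by rewrite pmulr_llt0 ?bneg // invr_gt0 phi0 //; lra.
have c0T' : 0 < c < T.
  move: c0T m0; rewrite in_itv /= /m => /andP[].
  rewrite le_eqVlt => /predU1P[<-|-> /=]; first by rewrite b0 mul0r ltxx.
  rewrite le_eqVlt => /predU1P[->|//].
  by rewrite bT mul0r !ltxx.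
pose k t := b t - m * phi t; pose k1 t := d t + 2 * m * C * t.
have k0 t : 0 <= t <= T -> 0 <= k t.
  move=> tT; rewrite /k subr_ge0 -ler_pdivlMr ?phi0 //.
  by apply: hmin; rewrite in_itv.
have kc : k c = 0 by rewrite /k /m mulfVK ?subrr // gt_eqF // phi0 //; lra.
have dk t : 0 < t < T -> is_derive t 1 k (k1 t).
  move=> tT; have dbt := db t tT.
  rewrite (_ : k = b - m *: (cst 1 - C *: (id ^+ 2))) //.
  by apply: is_derive_eq; rewrite /k1 /GRing.scale /= expr1; field.
have dk1 t : 0 < t < T -> is_derive t 1 k1 (e t + 2 * m * C).
  move=> tT; have ddt := dd t tT.
  rewrite (_ : k1 = d + (2 * m * C) *: id) //.
  by apply: is_derive_eq; rewrite /GRing.scale /=; field.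
have k1c : k1 c = 0.
  have dk' t : t \in `]0, T[%R -> derivable k t 1.
    by rewrite in_itv /= => /dk/@ex_derive.
  have := derive1_at_min (ltW T0) dk' (c := c).
  rewrite in_itv /= => /(_ c0T').
  have H t : t \in `]0, T[%R -> k c <= k t.
    by move=> tT; rewrite kc k0 // !ltW ?(itvP tT).
  by move=> /(_ H)/@derive_val <-; rewrite (@derive_val _ _ _ _ _ _ _ (dk _ c0T')).
(* At the minimum, b and d are known multiples of m. With u = C c^2 and v = 2 C c the bound on e
   gives m C (1 + u - v), negative because m < 0 and v < 1. *)
have Eneg : e c + 2 * m * C < 0.
  have bc : b c = m * phi c by apply/eqP; rewrite -subr_eq0 -/(k c) kc.
  have dc : d c = - (2 * m * C * c) by apply/eqP; rewrite -addr_eq0 -/(k1 c) k1c.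
  apply: (@le_lt_trans _ _ (C * (- b c + `|d c|) + 2 * m * C)).
    by rewrite lerD2r eC.
  have -> : `|d c| = d c.
    have cC : 0 < C * c by rewrite mulr_gt0 // (andP c0T').1.
    rewrite ger0_norm // dc (_ : - _ = 2 * ((- m) * (C * c))); last by ring.
    by apply: mulr_ge0 => //; apply: mulr_ge0; [rewrite oppr_ge0 ltW|exact: ltW].
  rewrite bc dc /phi.
  have : 2 * C * c < 1.
    by rewrite (le_lt_trans _ CT) // ler_pM2l ?mulr_gt0 // ltW // (andP c0T').2.
  have : 0 <= C * c ^+ 2 by rewrite mulr_ge0 ?sqr_ge0 // ltW.
  move: (C * c ^+ 2) => u u0 v1.
  have -> : C * (- (m * (1 - u)) + - (2 * m * C * c)) + 2 * m * C
     = (m * C) * (1 + (u - 2 * C * c)) by ring.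
  move: (2 * C * c) v1 => v v1.
  have uv : 0 < 1 + (u - v) by lra.
  by rewrite pmulr_llt0 // nmulr_rlt0.
(* [k1] vanishes at c with negative derivative, so it is negative just to the right of c. By the
   mean value theorem [k] becomes negative there, against its minimum 0. *)
have := @ex_derive _ _ _ _ _ _ _ (dk1 c c0T').
move=> /cvg_ex[l dl].
have lE : l = e c + 2 * m * C.
  rewrite -(@derive_val _ _ _ _ _ _ _ (dk1 c c0T')); apply/esym/cvg_lim => //; exact: dl.
move: dl => /cvgrPdist_lt/(_ (- (e c + 2 * m * C))).
rewrite oppr_gt0 => /(_ Eneg)/nbhs_ballP[r /= r0 rP].
pose s := Num.min (r / 2) ((T - c) / 2).
have s0 : 0 < s by rewrite lt_min; lra.
have sr : s < r by have : s <= r / 2; [rewrite ge_min lexx|lra].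
have sT : c + s < T.
  by have : s <= (T - c) / 2; [rewrite ge_min lexx orbT|lra].
have k1neg x : x \in `]c, (c + s)[%R -> k1 x < 0.
  rewrite in_itv /= => /andP[cx xs].
  have := rP (x - c); rewrite /ball /= sub0r normrN gtr0_norm ?subr_gt0 //.
  have -> : x - c < r by lra.
  rewrite subr_eq0 gt_eqF // => /(_ isT isT).
  rewrite /= [_ *: 1]mulr1 subrK k1c subr0 lE.
  rewrite ltr_norml /GRing.scale /= => /andP[+ _].
  by rewrite opprK ltrDl oppr_gt0 pmulr_rlt0 // invr_gt0 subr_gt0.
have [|||x xc E] := @MVT R k k1 c (c + s).
- by rewrite ltrDl.
- by move=> x; rewrite in_itv /= => xc; apply: dk; lra.
- apply: derivable_within_continuous => x; rewrite in_itv /= => xc.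
  by apply: (@ex_derive _ _ _ _ _ _ _ (dk x _)); lra.
have : k (c + s) < 0.
  by move: E; rewrite kc subr0 [c + s - c]addrAC subrr add0r => ->; rewrite pmulr_llt0 ?k1neg.
by rewrite ltNge k0 //; lra.
Qed.

(** F keeps the sign of a and stays at least |a| / 2 in absolute value, so the integral is compared
    with that of a / 2. *)
Lemma Rintegral_neq0 (F : R -> R) (T a : R) : 0 < T -> a != 0 ->
  {within `[0, T], continuous F} ->
  (forall t, 0 <= t <= T -> `|F t - a| <= `|a| / 2) ->
  \int[lebesgue_measure]_(t in `[0, T]) F t != 0.
Proof.
move=> T0 a0 cF Fa.
have iF : lebesgue_measure.-integrable `[0, T] (EFin \o F).
  by apply: continuous_compact_integrable cF; exact: segment_compact.
have ic (c : R) : lebesgue_measure.-integrable `[0, T] (EFin \o cst c).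
  apply: continuous_compact_integrable; first exact: segment_compact.
  by apply: continuous_subspaceT; exact: cst_continuous.
have Ic (c : R) : \int[lebesgue_measure]_(t in `[0, T]) c = c * T.
  by rewrite Rintegral_cst //= lebesgue_measure_itv /= lte_fin T0 /= subr0.
case: (ltgtP a 0) a0 => // sa _.
- have : \int[lebesgue_measure]_(t in `[0, T]) F t <= a / 2 * T.
    rewrite -Ic; apply: le_Rintegral => //; first exact: ic.
    move=> t /=; rewrite in_itv /= => /Fa.
    by rewrite (ltr0_norm sa) ler_norml => /andP[_]; lra.
  by move=> I; rewrite lt_eqF // (le_lt_trans I) //; nra.
- have : a / 2 * T <= \int[lebesgue_measure]_(t in `[0, T]) F t.
    rewrite -Ic; apply: le_Rintegral => //; first exact: ic.
    move=> t /=; rewrite in_itv /= => /Fa.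
    by rewrite (gtr0_norm sa) ler_norml => /andP[+ _]; lra.
  by move=> I; rewrite gt_eqF // (lt_le_trans _ I) //; nra.
Qed.

End OneVariable.

(** * Geodesics of a C11 metric *)

Section MetricBounds.
Local Open Scope classical_set_scope.
Local Open Scope ring_scope.
Context (R : realType) (n : nat).
Local Notation V := 'rV[R]_n.
Local Notation TM := ('rV[R]_n * 'rV[R]_n)%type.

Lemma bounded_lipschitz_det (T : normedModType R) (A : set T) m
    (M : T -> 'M[R]_m) :
  (forall i j, bounded_lipschitz A (fun x => M x i j)) ->
  bounded_lipschitz A (fun x => \det (M x)).
Proof.
move=> AM; apply: bounded_lipschitz_sum => s.
apply: bounded_lipschitzM; first exact: bounded_lipschitz_cst.
by apply: bounded_lipschitz_prod => i; exact: AM.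
Qed.

Lemma bounded_lipschitz_continuous (T : normedModType R) (A : set T) (F : T -> R) :
  bounded_lipschitz A F -> {within A, continuous F}.
Proof.
move=> [K K0 [_ FL]]; apply/subspace_continuousP => x Ax.
apply/cvgrPdist_le => e e0.
have K1 : 0 < K + 1 by rewrite ltr_pwDr.
rewrite /within /=; apply/nbhs_ballP; exists (e / (K + 1)) => /=; first exact: divr_gt0.
move=> y; rewrite -ball_normE /= => xy Ay.
rewrite (le_trans (FL _ _ Ax Ay)) //.
move: xy; rewrite ltr_pdivlMr // => /ltW; apply: le_trans.
by rewrite mulrC ler_wpM2l // lerDl.
Qed.

Lemma sqnorm_continuous : continuous (@sqnorm R n).
Proof.
move=> x; apply: differentiable_continuous.
rewrite (_ : @sqnorm R n = \sum_(i < n) (fun y : V => y 0 i) ^+ 2); last first.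
  by apply/funext => y; rewrite fct_sumE.
apply: differentiable_sum => i.
by apply: differentiableX; exact: differentiable_coord.
Qed.

Lemma compact_Mball : compact (@Mball R n).
Proof.
apply: bounded_closed_compact.
  exists 1; split; first exact: num_real.
  by move=> K K1 x /Mball_norm x1; apply: le_trans x1 _; exact: ltW.
have -> : @Mball R n = @sqnorm R n @^-1` [set y | y <= 1] by [].
by apply: preimage_closed; [move=> x _; exact: sqnorm_continuous|exact: closed_le].
Qed.

Variable g : V -> 'M[R]_n.
Hypothesis gC11 : C11_metric g.

Let gBL i j : bounded_lipschitz (@Mball R n) (fun x => g x i j).
Proof. by case: gC11 => gc _ _; exact: C11_bounded_lipschitz. Qed.

Lemma metric_det_neq0 x : Mball x -> \det (g x) != 0.
Proof.
case: gC11 => _ _ gpos Bx; apply/negP => /det0P[v v0 vg].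
by have := gpos _ _ Bx v0; rewrite /inner vg mul0mx mxE ltxx.
Qed.

Lemma metric_det_lower : exists2 d : R, 0 < d &
  forall x, Mball x -> d <= `|\det (g x)|.
Proof.
have B0 : @Mball R n !=set0.
  by exists 0; rewrite /Mball /= /sqnorm big1 // => i _; rewrite mxE expr0n.
have cd : {within @Mball R n, continuous (fun x => `|\det (g x)|)}.
  move=> x; apply: cvg_norm.
  exact: (bounded_lipschitz_continuous (bounded_lipschitz_det gBL)).
have [c /set_mem Bc cmin] := EVT_min_rV B0 compact_Mball cd.
exists `|\det (g c)|; first by rewrite normr_gt0 metric_det_neq0.
by move=> x Bx; apply: cmin; exact: mem_set.
Qed.

(** Cramer's formula: the entries are polynomials in those of g divided by the determinant, which
    compactness keeps away from 0. *)
Lemma bounded_lipschitz_invmx i j :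
  bounded_lipschitz (@Mball R n) (fun x => invmx (g x) i j).
Proof.
have [d d0 dP] := metric_det_lower.
have h : bounded_lipschitz (@Mball R n)
    (fun x => (\det (g x))^-1 * cofactor (g x) j i).
  apply: bounded_lipschitzM.
    exact: (bounded_lipschitzV d0 dP (bounded_lipschitz_det gBL)).
  apply: bounded_lipschitzM; first exact: bounded_lipschitz_cst.
  apply: bounded_lipschitz_det => k l.
  by apply: bounded_lipschitz_eq (gBL (lift j k) (lift i l)) => x _; rewrite !mxE.
apply: bounded_lipschitz_eq h => x Bx.
by rewrite /invmx unitmxE unitfE metric_det_neq0 // !mxE.
Qed.

Lemma bounded_lipschitz_christoffel i j k :
  bounded_lipschitz (@Mball R n) (christoffel g i j k).
Proof.
case: gC11 => gc _ _.
apply: bounded_lipschitzM; first exact: bounded_lipschitz_cst.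
apply: bounded_lipschitz_sum => l.
apply: bounded_lipschitzM; first exact: bounded_lipschitz_invmx.
apply: bounded_lipschitzB; last exact: C11_pderiv_bounded_lipschitz.
by apply: bounded_lipschitzD; exact: C11_pderiv_bounded_lipschitz.
Qed.

Lemma chris_bound : exists2 K : R, 0 <= K &
  forall x u i, Mball x -> `|chris g x u u 0 i| <= K * `|u| ^+ 2.
Proof.
have /(_ _)/cid2-/all_sig2[K K0 KP] := fun p : 'I_n * 'I_n * 'I_n =>
  bounded_lipschitz_christoffel p.1.1 p.1.2 p.2.
have K1 i : 0 <= \sum_j \sum_k K (i, j, k).
  by apply: sumr_ge0 => j _; exact: sumr_ge0.
exists (\sum_i \sum_j \sum_k K (i, j, k)); first exact: sumr_ge0.
move=> x u i Bx; rewrite mxE.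
apply: (@le_trans _ _ ((\sum_j \sum_k K (i, j, k)) * `|u| ^+ 2)); last first.
  by rewrite ler_wpM2r ?sqr_ge0 // [leRHS](bigD1 i) //= lerDl sumr_ge0.
rewrite (le_trans (ler_norm_sum _ _ _)) // mulr_suml ler_sum // => j _.
rewrite (le_trans (ler_norm_sum _ _ _)) // mulr_suml ler_sum // => k _.
rewrite 2!normrM -mulrA expr2; apply: ler_pM; rewrite ?mulr_ge0 //.
  by have [KP1 _] := KP (i, j, k); exact: KP1.
by apply: ler_pM => //; exact: coord_le_norm.
Qed.

(** Expressions polynomial in the velocity are Lipschitz only where the velocity is bounded. *)
Definition phase_ball (B : R) : set TM := [set z | Mball z.1 /\ `|z.2| <= B].

Lemma norm_fst_le (z : TM) : `|z.1| <= `|z|.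
Proof. by rewrite prod_normE le_max lexx. Qed.

Lemma norm_snd_le (z : TM) : `|z.2| <= `|z|.
Proof. by rewrite prod_normE le_max lexx orbT. Qed.

Lemma bounded_lipschitz_base (B : R) (F : V -> R) :
  bounded_lipschitz (@Mball R n) F ->
  bounded_lipschitz (phase_ball B) (fun z => F z.1).
Proof.
move=> [K K0 [FK FL]]; exists K => //; split => [z [Bz _]|z y [Bz _] [By _]].
  exact: FK.
rewrite (le_trans (FL _ _ Bz By)) // ler_wpM2l //.
exact: (norm_fst_le (z - y)).
Qed.

Lemma bounded_lipschitz_velocity (B : R) (i : 'I_n) :
  bounded_lipschitz (phase_ball B) (fun z => z.2 0 i).
Proof.
exists (`|B| + 1) => //; split => [z [_ zB]|z y _ _].
  rewrite (le_trans (coord_le_norm _ _)) // (le_trans zB) //.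
  by rewrite (le_trans (ler_norm _)) // lerDl.
have -> : z.2 0 i - y.2 0 i = (z - y).2 0 i by rewrite !mxE.
rewrite (le_trans (coord_le_norm _ _)) // (le_trans (norm_snd_le _)) //.
by rewrite ler_peMl // lerDr.
Qed.

(* Along a geodesic the second derivative of |x|^2 - 1 is [2 * bending], so on
   tangent vectors [bending > 0] is strict convexity of the boundary. *)
Definition bending (z : TM) : R :=
  \sum_i (z.2 0 i ^+ 2 - z.1 0 i * chris g z.1 z.2 z.2 0 i).

Lemma bounded_lipschitz_bending B : bounded_lipschitz (phase_ball B) bending.
Proof.
apply: bounded_lipschitz_sum => i; apply: bounded_lipschitzB.
  by apply: bounded_lipschitzM; exact: bounded_lipschitz_velocity.
apply: bounded_lipschitzM.
  by apply: (@bounded_lipschitz_base B (fun x => x 0 i)); exact/C11_bounded_lipschitz/C11_coord.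
have h : bounded_lipschitz (phase_ball B) (fun z =>
    \sum_j \sum_k christoffel g i j k z.1 * z.2 0 j * z.2 0 k).
  apply: bounded_lipschitz_sum => j; apply: bounded_lipschitz_sum => k.
  apply: bounded_lipschitzM; last exact: bounded_lipschitz_velocity.
  apply: bounded_lipschitzM; last exact: bounded_lipschitz_velocity.
  exact/bounded_lipschitz_base/bounded_lipschitz_christoffel.
by apply: bounded_lipschitz_eq h => z _; rewrite mxE.
Qed.

Lemma bounded_lipschitz_eval B m (f : V -> tensor R n m) : C11_field f ->
  bounded_lipschitz (phase_ball B) (eval_field f).
Proof.
move=> fc; apply: bounded_lipschitz_sum => J; apply: bounded_lipschitzM.
  exact: (bounded_lipschitz_base B (C11_bounded_lipschitz (fc J))).
by apply: bounded_lipschitz_prod => a; exact: bounded_lipschitz_velocity.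
Qed.

End MetricBounds.

Section GeodesicCalculus.
Local Open Scope classical_set_scope.
Local Open Scope ring_scope.
Context (R : realType) (n : nat).
Local Notation V := 'rV[R]_n.
Local Notation TM := ('rV[R]_n * 'rV[R]_n)%type.

Lemma is_derive_coord (u : R -> V) (t : R) (du : V) i :
  is_derive t 1 u du -> is_derive t 1 (fun s => u s 0 i) (du 0 i).
Proof.
move=> [udr ude]; apply: DeriveDef; first exact: (derivable_mxP u t 1).1 udr 0 i.
by rewrite -ude derive_mx // mxE.
Qed.

Lemma lipschitz_comp_continuous (A : set TM) (F : TM -> R) (K : R) (I : set R)
    (c : R -> TM) : 0 <= K ->
  (forall z y, A z -> A y -> `|F z - F y| <= K * `|z - y|) ->
  (forall t, I t -> A (c t)) ->
  {within I, continuous c} -> {within I, continuous (F \o c)}.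
Proof.
move=> K0 FL cA cc; apply/subspace_continuousP => t It.
apply/cvgrPdist_le => e e0.
have K1 : 0 < K + 1 by rewrite ltr_pwDr.
have Q : nbhs t (fun s => I s -> ball (c t) (e / (K + 1)) (c s)) :=
  (subspace_continuousP _ c).1 cc t It _ (nbhsx_ballx (c t) _ (divr_gt0 e0 K1)).
change (nbhs t (fun s => I s -> `|F (c t) - F (c s)| <= e)).
apply: filterS Q => s sP Is.
rewrite (le_trans (FL _ _ (cA _ It) (cA _ Is))) //.
have := sP Is; rewrite -ball_normE /= ltr_pdivlMr // => /ltW; apply: le_trans.
by rewrite mulrC ler_wpM2l // lerDl.
Qed.

Lemma bounded_lipschitz_comp_continuous (A : set TM) (F : TM -> R) (I : set R)
    (c : R -> TM) :
  bounded_lipschitz A F -> (forall t, I t -> A (c t)) ->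
  {within I, continuous c} -> {within I, continuous (F \o c)}.
Proof. by move=> [K K0 [_ FL]]; exact: lipschitz_comp_continuous FL. Qed.

Variable g : V -> 'M[R]_n.

Lemma geodesic_on_sub (I J : set R) c : J `<=` I ->
  geodesic_on g I c -> geodesic_on g J c.
Proof.
move=> JI [cc cB cd]; split.
- exact: continuous_subspaceW cc.
- by move=> t /JI; exact: cB.
- by move=> t Jt; apply: cd; apply: filterS Jt.
Qed.

Section AlongGeodesic.
Variables (T : R) (c : R -> TM).
Hypothesis geo : geodesic_on g `[0, T] c.

Lemma geodesic_Mball t : 0 <= t <= T -> Mball (c t).1.
Proof. by move=> tT; case: geo => _ + _; apply; rewrite /= in_itv. Qed.

Lemma geodesic_position_derive t i : 0 < t < T ->
  is_derive t 1 (fun s => (c s).1 0 i) ((c t).2 0 i).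
Proof.
move=> tT; case: geo => _ _ /(_ t); rewrite interior_itv_bnd /= in_itv /=.
by move=> /(_ tT)[h _]; exact: is_derive_coord h.
Qed.

Lemma geodesic_velocity_derive t i : 0 < t < T ->
  is_derive t 1 (fun s => (c s).2 0 i) (- chris g (c t).1 (c t).2 (c t).2 0 i).
Proof.
move=> tT; case: geo => _ _ /(_ t); rewrite interior_itv_bnd /= in_itv /=.
move=> /(_ tT)[_ h].
by have := is_derive_coord i h; rewrite mxE.
Qed.

Lemma geodesic_position_continuous i :
  {within `[0, T], continuous (fun s => (c s).1 0 i)}.
Proof.
case: geo => cc _ _.
apply: (@lipschitz_comp_continuous setT (fun z => z.1 0 i) 1 _ _ ler01 _ _ cc) => //.
move=> z y _ _; rewrite mul1r (_ : _ - _ = (z - y).1 0 i); last by rewrite !mxE.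
exact: le_trans (coord_le_norm _ _) (norm_fst_le _).
Qed.

Lemma geodesic_velocity_continuous i :
  {within `[0, T], continuous (fun s => (c s).2 0 i)}.
Proof.
case: geo => cc _ _.
apply: (@lipschitz_comp_continuous setT (fun z => z.2 0 i) 1 _ _ ler01 _ _ cc) => //.
move=> z y _ _; rewrite mul1r (_ : _ - _ = (z - y).2 0 i); last by rewrite !mxE.
exact: le_trans (coord_le_norm _ _) (norm_snd_le _).
Qed.

Lemma geodesic_sqnorm_derive t : 0 < t < T ->
  is_derive t 1 (fun s => sqnorm (c s).1 - 1) (2 * dotp (c t).1 (c t).2).
Proof.
move=> tT.
rewrite (_ : (fun _ => _) = \sum_(i < n) (fun s => (c s).1 0 i) ^+ 2 - cst 1); last first.
  by apply/funext => s; rewrite /sqnorm -[RHS]/((\sum_(i < n) (fun s => (c s).1 0 i) ^+ 2) s - 1) fct_sumE.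
have h i := geodesic_position_derive i tT.
apply: is_derive_eq; rewrite subr0 /dotp mulr_sumr.
by apply: eq_bigr => i _; rewrite /GRing.scale /= expr1 mulrA.
Qed.

Lemma geodesic_dotp_derive t : 0 < t < T ->
  is_derive t 1 (fun s => 2 * dotp (c s).1 (c s).2) (2 * bending g (c t)).
Proof.
move=> tT.
rewrite (_ : (fun _ => _) = 2 *: \sum_(i < n) ((fun s => (c s).1 0 i) * (fun s => (c s).2 0 i))); last first.
  by apply/funext => s; rewrite /dotp -[RHS]/(2 * ((\sum_(i < n) ((fun s => (c s).1 0 i) * (fun s => (c s).2 0 i))) s)) fct_sumE.
have h i := geodesic_position_derive i tT.
have h' i := geodesic_velocity_derive i tT.
apply: is_derive_eq; rewrite /bending /GRing.scale /=; congr (_ * _).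
by apply: eq_bigr => i _; ring.
Qed.

Lemma geodesic_sqnorm_continuous :
  {within `[0, T], continuous (fun s => sqnorm (c s).1 - 1)}.
Proof.
apply/subspace_continuousP => t tT; apply: cvgB; last exact: cvg_cst.
apply: cvg_big => [|i _]; first exact: add_continuous.
have h := (subspace_continuousP _ _).1 (@geodesic_position_continuous i) t tT.
exact: (cvgM h h).
Qed.

Lemma geodesic_dotp_continuous :
  {within `[0, T], continuous (fun s => 2 * dotp (c s).1 (c s).2)}.
Proof.
apply/subspace_continuousP => t tT; apply: cvgM; first exact: cvg_cst.
apply: cvg_big => [|i _]; first exact: add_continuous.
apply: cvgM.
  exact: (subspace_continuousP _ _).1 (@geodesic_position_continuous i) t tT.
exact: (subspace_continuousP _ _).1 (@geodesic_velocity_continuous i) t tT.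
Qed.

End AlongGeodesic.

End GeodesicCalculus.

(** * A priori estimates for geodesics on short intervals *)

Section ShortTime.
Local Open Scope classical_set_scope.
Local Open Scope ring_scope.
Context (R : realType) (n : nat).
Local Notation V := 'rV[R]_n.
Local Notation TM := ('rV[R]_n * 'rV[R]_n)%type.

Lemma sqnorm_ge0 (v : V) : 0 <= sqnorm v.
Proof. by apply: sumr_ge0 => i _; exact: sqr_ge0. Qed.

Lemma sqr_norm_le_sqnorm (v : V) : `|v| ^+ 2 <= sqnorm v.
Proof.
have : `|v| <= Num.sqrt (sqnorm v).
  apply: norm_le_coord => // i; rewrite -sqrtr_sqr ler_sqrt ?sqnorm_ge0 //.
  by rewrite /sqnorm (bigD1 i) //= lerDl sumr_ge0 // => j _; exact: sqr_ge0.
by rewrite -(@ler_pXn2r _ 2) ?nnegrE // sqr_sqrtr ?sqnorm_ge0.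
Qed.

Lemma sqnorm_le_sqr_norm (v : V) : sqnorm v <= n%:R * `|v| ^+ 2.
Proof.
rewrite /sqnorm mulr_natl -[X in _ *+ X]card_ord -sumr_const ler_sum // => i _.
by rewrite -(real_normK (num_real (v 0 i))) ler_pXn2r ?nnegrE // coord_le_norm.
Qed.

Variable g : V -> 'M[R]_n.
Hypothesis gC11 : C11_metric g.

(* With q = |v|^2 the geodesic equation gives |q'| <= L (1 + q)^2, so
   1 / (1 + q) is Lipschitz and q stays bounded for a short time. *)
Lemma geodesic_short_time (B : R) : 0 <= B ->
  exists2 delta : R, 0 < delta & exists2 C : R, 0 <= C &
    forall T c, T <= delta -> geodesic_on g `[0, T] c -> `|(c 0).2| <= B ->
      forall t, 0 <= t <= T -> `|c t - c 0| <= C * t /\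
        forall i, `|(c t).1 0 i - (c 0).1 0 i - t * (c 0).2 0 i| <= C * t ^+ 2.
Proof.
move=> B0; have [K K0 KP] := chris_bound gC11.
pose L := 2 * n%:R * K; pose Q := 1 + n%:R * B ^+ 2.
have L0 : 0 <= L by rewrite /L !mulr_ge0.
have Q1 : 1 <= Q by rewrite /Q lerDl mulr_ge0 ?sqr_ge0.
have Q0 : 0 < Q := lt_le_trans ltr01 Q1.
have QL0 : 0 < 2 * Q * (L + 1) by rewrite !mulr_gt0 // ltr_wpDl.
(* Initially 1 / (1 + q) is at least 1 / Q. Decreasing at rate at most L, it keeps half of this
   value during this time, so 1 + q stays below 2 Q, which is [W]. *)
exists (2 * Q * (L + 1))^-1; first by rewrite invr_gt0.
pose W := 2 * Q; pose C := W + K * W ^+ 2.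
have KW : 0 <= K * W ^+ 2 by rewrite mulr_ge0 ?sqr_ge0.
have W0 : 0 <= W by rewrite /W mulr_ge0 // ltW.
exists C; first by rewrite addr_ge0.
move=> T c TD geo cB.
pose q t := sqnorm (c t).2.
have q1 t : 0 < 1 + q t by rewrite ltr_wpDr // sqnorm_ge0.
pose dq t := \sum_i 2 * ((c t).2 0 i * - chris g (c t).1 (c t).2 (c t).2 0 i).
have dqE t : 0 < t < T -> is_derive t 1 (fun s => 1 + q s) (dq t).
  move=> tT; have h i := geodesic_velocity_derive geo i tT.
  rewrite (_ : (fun _ => _) = cst 1 + \sum_(i < n) (fun s => (c s).2 0 i) ^+ 2); last first.
    by apply/funext => s; rewrite /q /sqnorm -[RHS]/(1 + ((\sum_(i < n) (fun s => (c s).2 0 i) ^+ 2) s)) fct_sumE.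
  apply: is_derive_eq; rewrite add0r /dq.
  by apply: eq_bigr => i _; rewrite /GRing.scale /= expr1 mulrA.
have dqb t : 0 < t < T -> `|dq t| <= L * (1 + q t) ^+ 2.
  move=> /andP[t0 tT]; have Bt : Mball (c t).1 by apply: (geodesic_Mball geo); rewrite !ltW.
  have v1 : `|(c t).2| <= 1 + q t.
    have := sqr_norm_le_sqnorm (c t).2; rewrite -/(q t); nra.
  have v2 : `|(c t).2| ^+ 2 <= 1 + q t.
    by rewrite (le_trans (sqr_norm_le_sqnorm _)) // lerDr.
  rewrite (le_trans (ler_norm_sum _ _ _)) //.
  have -> : L * (1 + q t) ^+ 2 = \sum_(i < n) 2 * (K * (1 + q t) ^+ 2).
    by rewrite sumr_const card_ord -mulr_natl /L; ring.
  apply: ler_sum => i _.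
  rewrite normrM ger0_norm // ler_wpM2l // normrM normrN.
  apply: (@le_trans _ _ ((1 + q t) * (K * (1 + q t)))); last by rewrite mulrCA.
  apply: ler_pM => //; first by rewrite (le_trans (coord_le_norm _ _)).
  by rewrite (le_trans (KP _ _ _ Bt)) // ler_wpM2l.
pose r t := (1 + q t)^-1.
have rE t : 0 < t < T -> is_derive t 1 r (- (1 + q t) ^- 2 *: dq t).
  move=> tT; have h := dqE t tT; have q0 : 1 + q t != 0 by rewrite gt_eqF.
  apply: DeriveDef; first by apply: derivableV => //; exact: (@ex_derive _ _ _ _ _ _ _ h).
  by rewrite deriveV ?derive_val //; exact: (@ex_derive _ _ _ _ _ _ _ h).
have rb t : 0 < t < T -> `|- (1 + q t) ^- 2 *: dq t| <= L.
  move=> tT; rewrite normrZ normrN normfV ger0_norm ?sqr_ge0 //.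
  by rewrite mulrC ler_pdivrMr ?exprn_gt0 // dqb.
have cr : {within `[0, T], continuous r}.
  apply/subspace_continuousP => t tT; apply: cvgV; first by rewrite gt_eqF.
  apply: cvgD; first exact: cvg_cst.
  apply: cvg_big => [|i _]; first exact: add_continuous.
  have h := (subspace_continuousP _ _).1 (@geodesic_velocity_continuous _ _ _ _ _ geo i) t tT.
  exact: (cvgM h h).
have q0Q : 1 + q 0 <= Q.
  rewrite /Q lerD2l (le_trans (sqnorm_le_sqr_norm _)) // ler_wpM2l //.
  by rewrite ler_pXn2r ?nnegrE.
have vW t : 0 <= t <= T -> `|(c t).2| <= W.
  move=> tT; have [t0 tT'] := andP tT.
  have qW : 1 + q t <= W.
    rewrite -(@lef_pV2 _ W) ?posrE //; last by rewrite /W mulr_gt0.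
    have r0 : Q^-1 <= r 0 by rewrite lef_pV2 ?posrE.
    have := derivative_bound cr rE (fun s sT _ => rb s sT) tT.
    rewrite ler_norml -/(r t) => /andP[+ _].
    have : L * t <= W^-1.
      rewrite (@le_trans _ _ (L * (2 * Q * (L + 1))^-1)) ?ler_wpM2l ?(le_trans tT') //.
      rewrite invfM mulrCA ler_piMr ?invr_ge0 //.
      by rewrite ler_pdivrMr ?mul1r ?lerDl // ltr_wpDl.
    have -> : W^-1 = Q^-1 / 2 by rewrite /W invfM mulrC.
    lra.
  by have := sqr_norm_le_sqnorm (c t).2; rewrite -/(q t); nra.
have xb t i : 0 <= t <= T -> `|(c t).1 0 i - (c 0).1 0 i| <= W * t.
  apply: (derivative_bound (@geodesic_position_continuous _ _ _ _ _ geo i)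
    (fun s sT => geodesic_position_derive geo i sT)) => s /andP[s0 sT] _.
  by rewrite (le_trans (coord_le_norm _ _)) // vW // !ltW.
have vb t i : 0 <= t <= T -> `|(c t).2 0 i - (c 0).2 0 i| <= K * W ^+ 2 * t.
  apply: (derivative_bound (@geodesic_velocity_continuous _ _ _ _ _ geo i)
    (fun s sT => geodesic_velocity_derive geo i sT)) => s /andP[s0 sT] _.
  have sT' : 0 <= s <= T by rewrite !ltW.
  rewrite normrN (le_trans (KP _ _ _ (geodesic_Mball geo sT'))) // ler_wpM2l //.
  by rewrite ler_pXn2r ?nnegrE // vW.
move=> t tT; have [t0 tT'] := andP tT; split.
  have Ct : 0 <= C * t by rewrite mulr_ge0 // addr_ge0.
  rewrite prod_normE ge_max; apply/andP; split; apply: norm_le_coord => // i.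
    by rewrite !mxE (le_trans (xb t i tT)) // ler_wpM2r // lerDl.
  by rewrite !mxE (le_trans (vb t i tT)) // ler_wpM2r // lerDr.
(* Second-order estimate: the derivative of [h] minus its initial velocity term is the change of
   velocity, at most K W^2 t before time t, so the position deviates from its linear part by at most
   K W^2 t^2. *)
move=> i; pose h s := (c s).1 0 i - s * (c 0).2 0 i.
have ch : {within `[0, T], continuous h}.
  apply/subspace_continuousP => s sT; apply: cvgB.
    exact: (subspace_continuousP _ _).1 (@geodesic_position_continuous _ _ _ _ _ geo i) s sT.
  have cl : continuous (fun s : R => s * (c 0).2 0 i).
    by move=> u; apply: cvgM; [exact: cvg_id|exact: cvg_cst].
  exact: (subspace_continuousP _ _).1 (continuous_subspaceT cl) s sT.
have hE s : 0 < s < T -> is_derive s 1 h ((c s).2 0 i - (c 0).2 0 i).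
  move=> sT; have hp := geodesic_position_derive geo i sT.
  rewrite (_ : h = (fun s => (c s).1 0 i) - (c 0).2 0 i *: id); last first.
    by apply/funext => u; rewrite /h mulrC.
  by apply: is_derive_eq; rewrite /GRing.scale /= mulr1.
have hb s : 0 < s < T -> s < t -> `|(c s).2 0 i - (c 0).2 0 i| <= K * W ^+ 2 * t.
  move=> /andP[s0 sT] st; rewrite (le_trans (vb s i _)) ?(ltW s0) ?(ltW sT) //.
  by rewrite ler_wpM2l // ltW.
have := derivative_bound ch hE hb tT.
rewrite /h mul0r subr0 addrAC => /le_trans; apply.
by rewrite -mulrA -expr2 ler_wpM2r ?sqr_ge0 // lerDr.
Qed.

End ShortTime.

(** * Short chords *)

Section ShortChords.
Local Open Scope classical_set_scope.
Local Open Scope ring_scope.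
Context (R : realType) (n : nat).
Local Notation V := 'rV[R]_n.
Local Notation TM := ('rV[R]_n * 'rV[R]_n)%type.
Variable g : V -> 'M[R]_n.
Hypothesis gC11 : C11_metric g.

Section Inner.
Variable x : V.
Hypothesis Bx : Mball x.

Lemma innerDl u v w : inner g x (u + v) w = inner g x u w + inner g x v w.
Proof. by rewrite /inner !mulmxDl mxE. Qed.

Lemma innerZl a u v : inner g x (a *: u) v = a * inner g x u v.
Proof. by rewrite /inner -!scalemxAl mxE. Qed.

Lemma inner_sym u v : inner g x u v = inner g x v u.
Proof.
case: gC11 => _ gs _; rewrite /inner.
transitivity ((u *m g x *m v^T)^T 0 0); first by rewrite [RHS]mxE.
by rewrite !trmx_mul trmxK gs // mulmxA.
Qed.

Lemma innerDr u v w : inner g x u (v + w) = inner g x u v + inner g x u w.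
Proof. by rewrite inner_sym innerDl !(inner_sym _ u). Qed.

Lemma innerZr a u v : inner g x u (a *: v) = a * inner g x u v.
Proof. by rewrite inner_sym innerZl inner_sym. Qed.

Lemma inner_ge0 v : 0 <= inner g x v v.
Proof.
have [->|v0] := eqVneq v 0; first by rewrite /inner !mul0mx mxE.
by case: gC11 => _ _ gp; exact/ltW/gp.
Qed.

Lemma inner_bound : exists2 G : R, 0 <= G &
  forall u v, `|inner g x u v| <= G * (`|u| * `|v|).
Proof.
exists (\sum_j \sum_i `|g x i j|); first by do 2!apply: sumr_ge0 => ? _.
move=> u v; rewrite /inner mxE (le_trans (ler_norm_sum _ _ _)) // mulr_suml.
apply: ler_sum => j _; rewrite !mxE normrM.
apply: (@le_trans _ _ ((\sum_i `|u| * `|g x i j|) * `|v|)).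
  apply: ler_pM => //; last exact: coord_le_norm.
  rewrite (le_trans (ler_norm_sum _ _ _)) // ler_sum // => i _.
  by rewrite normrM ler_wpM2r // coord_le_norm.
by rewrite -mulr_sumr mulrCA mulrA.
Qed.

(** Each coordinate of w is its inner product with the vector [dual i], a column of the inverse of
    g, so Cauchy-Schwarz bounds it. The bound 1 + |dual|^2 avoids a square root. *)
Lemma unit_velocity_bound : exists2 B : R, 0 <= B &
  forall w, inner g x w w = 1 -> `|w| <= B.
Proof.
pose dual i : V := (col i (invmx (g x)))^T.
exists (\sum_i (1 + inner g x (dual i) (dual i))).
  by apply: sumr_ge0 => i _; rewrite addr_ge0 // inner_ge0.
move=> w w1; apply: norm_le_coord => [|i].
  by apply: sumr_ge0 => i _; rewrite addr_ge0 // inner_ge0.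
have gu : g x \in unitmx by rewrite unitmxE unitfE metric_det_neq0.
have wi : w 0 i = inner g x w (dual i).
  by rewrite /inner /dual trmxK -[in LHS](mulmxK gu w) mxE [RHS]mxE; apply: eq_bigr => k _; congr (_ * _); rewrite mxE.
apply: (@le_trans _ _ (1 + inner g x (dual i) (dual i))); last first.
  rewrite (bigD1 i) //= lerDl sumr_ge0 // => j _.
  by rewrite addr_ge0 // inner_ge0.
rewrite wi; set a := inner g x w (dual i).
have := inner_ge0 (dual i + (- a) *: w).
rewrite innerDl !innerDr !innerZl !innerZr w1 (inner_sym (dual i) w) -/a.
set d := inner g x (dual i) (dual i) => h.
have : a ^+ 2 <= d by rewrite expr2; nra.
rewrite -real_normK ?num_real //; have := normr_ge0 a; move: `|a| => b b0; nra.
Qed.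

(** Both v and w are unit vectors. Comparing the squared lengths of the two sides of the relation
    forces a^2, hence the nonnegative a, to be near 1, and then w to be near v. For a chord, r is
    the Taylor remainder divided by the length. *)
Lemma direction_close (v z : V) (e : R) : inner g x v v = 1 -> 0 < e ->
  exists2 d : R, 0 < d & forall s a w r, 0 <= s -> s <= d -> 0 <= a ->
    inner g x w w = 1 -> `|r| <= d -> a *: (v - s *: z) = w + r -> `|w - v| < e.
Proof.
move=> v1 e0; have [B B0 BP] := unit_velocity_bound.
have [G G0 GP] := inner_bound.
(* Up to the factor d, these bound in turn the errors of |v - s z|^2 from 1, of a^2 |v - s z|^2 from
   1, of a from 1, and of w from v. The condition d D1 <= 1 / 2 keeps |v - s z|^2 at least 1 / 2,
   which bounds a^2. *)
pose D1 := 2 * `|inner g x v z| + `|inner g x z z|.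
pose D2 := 2 * G * B + G.
pose D3 := D2 + 2 * (1 + D2) * D1.
pose D4 := D3 * (`|v| + `|z|) + `|z| + 1.
have D10 : 0 <= D1 by rewrite /D1 addr_ge0 // mulr_ge0.
have D20 : 0 <= D2 by rewrite /D2 addr_ge0 // !mulr_ge0.
have D30 : 0 <= D3 by rewrite /D3 addr_ge0 // !mulr_ge0 // addr_ge0.
have D40 : 0 < D4 by rewrite /D4 ltr_wpDl // addr_ge0 // mulr_ge0 // addr_ge0.
pose d := Num.min 1 (Num.min (2 * (D1 + 1))^-1 (e / (2 * D4))).
have d0 : 0 < d.
  by rewrite !lt_min ltr01 invr_gt0 divr_gt0 //= ?mulr_gt0 // ltr_wpDl.
exists d => // s a w r s0 sd a0 w1 rd E.
have d1 : d <= 1 by rewrite ge_min lexx.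
have dD1 : d * D1 <= 1 / 2.
  have : d <= (2 * (D1 + 1))^-1 by rewrite !ge_min lexx orbT.
  rewrite -[(_ * _)^-1]mul1r ler_pdivlMr; last by rewrite mulr_gt0 // ltr_wpDl.
  nra.
have dD4 : d * D4 <= e / 2.
  have : d <= e / (2 * D4) by rewrite !ge_min lexx !orbT.
  rewrite ler_pdivlMr; last by rewrite mulr_gt0.
  lra.
set u := v - s *: z in E.
set nu := inner g x u u.
have nu1 : `|nu - 1| <= d * D1.
  have -> : nu - 1 = - (s * (2 * inner g x v z)) + s * (s * inner g x z z).
    rewrite /nu /u -scaleNr innerDl !innerDr !innerZl !innerZr v1 (inner_sym z v); ring.
  rewrite (le_trans (ler_normD _ _)) // normrN !normrM !(ger0_norm s0) (ger0_norm (ler0n R 2)).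
  have s1 : s <= 1 := le_trans sd d1.
  rewrite /D1 mulrDr lerD //; first by rewrite ler_wpM2r // mulr_ge0.
  by rewrite ler_pM ?mulr_ge0 // ler_piMl.
have an : `|a ^+ 2 * nu - 1| <= d * D2.
  have -> : a ^+ 2 * nu - 1 = 2 * inner g x w r + inner g x r r.
    have -> : a ^+ 2 * nu = inner g x (a *: u) (a *: u) by rewrite innerZl innerZr mulrA.
    rewrite E innerDl !innerDr w1 (inner_sym r w); ring.
  rewrite (le_trans (ler_normD _ _)) // normrM (ger0_norm (ler0n R 2)).
  have r1 := GP w r; have r2 := GP r r; have wB := BP w w1.
  have rr := normr_ge0 r.
  have r3 : `|w| * `|r| <= B * d by apply: ler_pM.
  have r4 : `|r| * `|r| <= 1 * d by apply: ler_pM => //; exact: le_trans rd d1.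
  have r5 := ler_wpM2l G0 r3; have r6 := ler_wpM2l G0 r4.
  rewrite /D2; lra.
have nu2 : 1 / 2 <= nu by move: nu1; rewrite ler_norml => /andP[]; lra.
have dD2 : d * D2 <= D2 by rewrite ler_piMl.
have a2 : a ^+ 2 <= 2 * (1 + D2).
  have : a ^+ 2 * (1 / 2) <= a ^+ 2 * nu by rewrite ler_wpM2l ?sqr_ge0.
  by move: an; rewrite ler_norml => /andP[]; lra.
have a1 : `|a ^+ 2 - 1| <= d * D3.
  have -> : a ^+ 2 - 1 = (a ^+ 2 * nu - 1) - a ^+ 2 * (nu - 1) by ring.
  rewrite (le_trans (ler_normB _ _)) // normrM (ger0_norm (sqr_ge0 a)).
  have := ler_pM (sqr_ge0 a) (normr_ge0 (nu - 1)) a2 nu1.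
  rewrite /D3; lra.
have a1' : `|a - 1| <= d * D3.
  apply: le_trans a1; have -> : a ^+ 2 - 1 = (a - 1) * (a + 1) by ring.
  by rewrite normrM ler_peMr // ger0_norm ?addr_ge0 // lerDr.
have -> : w - v = (a - 1) *: u + (- s) *: z - r.
  rewrite scalerBl E scale1r /u; apply/rowP => i; rewrite !mxE; ring.
rewrite (le_lt_trans (ler_normB _ _)) // (le_lt_trans (lerD (ler_normD _ _) (lexx _))) //.
rewrite !normrZ normrN (ger0_norm s0).
have uB : `|u| <= `|v| + `|z|.
  rewrite (le_trans (ler_normB _ _)) // lerD2l normrZ (ger0_norm s0).
  by rewrite ler_piMl // (le_trans sd).
have h1 := ler_pM (normr_ge0 _) (normr_ge0 _) a1' uB.
have h2 : s * `|z| <= d * `|z| by rewrite ler_wpM2r.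
apply: (@le_lt_trans _ _ (d * D4)); last by lra.
rewrite /D4; lra.
Qed.

End Inner.

End ShortChords.

Section Chords.
Local Open Scope classical_set_scope.
Local Open Scope ring_scope.
Context (R : realType) (n : nat).
Local Notation V := 'rV[R]_n.
Local Notation TM := ('rV[R]_n * 'rV[R]_n)%type.
Variable g : V -> 'M[R]_n.
Hypothesis gC11 : C11_metric g.
Hypothesis joinable : uniquely_joined g.

Lemma sqnorm_lincomb (a b : R) (x v : V) :
  sqnorm (a *: x + b *: v) = a ^+ 2 * sqnorm x + 2 * a * b * dotp x v + b ^+ 2 * sqnorm v.
Proof.
rewrite /sqnorm /dotp !mulr_sumr -!big_split; apply: eq_bigr => i _ /=.
by rewrite !mxE; ring.
Qed.

(* Rational parametrization of the great circle through [x] in the tangential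
   direction [v]. *)
Definition circle_point (x v : V) (s : R) : V :=
  (1 + s ^+ 2 * sqnorm v)^-1 *:
    ((1 - s ^+ 2 * sqnorm v) *: x + (2 * s) *: v).

Lemma circle_point_Mbd x v s : Mbd x -> dotp x v = 0 -> Mbd (circle_point x v s).
Proof.
move=> bx xv; rewrite /Mbd /= /circle_point scalerDr !scalerA sqnorm_lincomb xv bx.
have : 1 + s ^+ 2 * sqnorm v != 0.
  by rewrite gt_eqF // ltr_wpDr // mulr_ge0 ?sqr_ge0 ?sqnorm_ge0.
by move: (sqnorm v) => k k0; field.
Qed.

(** The displacement in the form required by [direction_close]: a multiple of v with a correction
    along the normal of relative size s. *)
Lemma circle_point_sub x v s : circle_point x v s - x =
  (2 * s / (1 + s ^+ 2 * sqnorm v)) *: (v - s *: (sqnorm v *: x)).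
Proof.
have : 1 + s ^+ 2 * sqnorm v != 0.
  by rewrite gt_eqF // ltr_wpDr // mulr_ge0 ?sqr_ge0 ?sqnorm_ge0.
by rewrite /circle_point; move: (sqnorm v) => k k0; apply/rowP => i; rewrite !mxE; field.
Qed.

Lemma Mbd_Mball (x : V) : Mbd x -> Mball x.
Proof. by rewrite /Mbd /Mball /= => ->. Qed.

Lemma geodesic_on_point (z : TM) : Mball z.1 -> geodesic_on g `[0, 0] (cst z).
Proof.
move=> Bz; split => //; first by apply: continuous_subspaceT; exact: cst_continuous.
by move=> t; rewrite interior_itv_bnd /= in_itv /= => /andP[t0 /(lt_trans t0)]; rewrite ltxx.
Qed.

(** A constant curve joins x to itself with length 0, so uniqueness gives [ell (x, x) = 0] and
    continuity makes nearby joins short. The unit vector v serves as the velocity of the constant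
    curve. *)
Lemma join_length_small x v (e : R) : Mball x -> inner g x v v = 1 -> 0 < e ->
  exists2 r : R, 0 < r & forall y, Mball y -> `|y - x| < r ->
    exists l c, joins g x y l c /\ l < e.
Proof.
move=> Bx v1 e0; case: joinable => ell cell ellP.
have [c0 _ uniq0] := ellP x x Bx Bx.
have j0 : joins g x x 0 (cst (x, v)).
  split => //; first exact: geodesic_on_point.
  by move=> t /andP[t0 /(lt_trans t0)]; rewrite ltxx.
have [ell0 _] := uniq0 _ _ j0.
pose D : set TM := [set p | Mball p.1 /\ Mball p.2].
have Q : nbhs (x, x) (fun p => D p -> ball (ell (x, x)) e (ell p)) :=
  (subspace_continuousP D ell).1 cell (x, x) (conj Bx Bx) _ (nbhsx_ballx _ _ e0).
move: Q => /nbhs_ballP[r /= r0 rP]; exists r => // y By yx.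
have [c jc _] := ellP x y Bx By; exists (ell (x, y)), c; split => //.
have := rP (x, y); rewrite -ball_normE /= => /(_ _ (conj Bx By)).
rewrite -ell0 -ball_normE /= sub0r normrN => h.
apply: le_lt_trans (ler_norm _) (h _).
by rewrite prod_normE /= subrr normr0 gt_max r0 /= distrC.
Qed.

(** The chord joins x to a point of the great circle in direction v. Its direction is controlled by
    comparing the displacement along the circle with the second-order estimate along the
    geodesic. *)
Lemma short_chord x v (e : R) : Mbd x -> dotp x v = 0 -> inner g x v v = 1 -> 0 < e ->
  exists l c, [/\ 0 < l < e, geodesic_on g `[0, l] c, SM g (c 0) /\ (c 0).1 = x,
    Mbd (c l).1 /\ (forall t, 0 < t < l -> Mint (c t).1) &
    forall t, 0 <= t <= l -> `|c t - (x, v)| < e].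
Proof.
move=> bx xv v1 e0; have Bx := Mbd_Mball bx.
have [B B0 BP] := unit_velocity_bound gC11 Bx.
have [delta delta0 [C C0 CP]] := geodesic_short_time gC11 B0.
set z := sqnorm v *: x.
have [d d0 dP] := direction_close gC11 Bx z v1 (divr_gt0 e0 (ltr0n R 2)).
(* For lengths below [eta], the short-time estimates apply ([delta]), the scaled remainder is at
   most d, and the whole chord stays within e / 2 of its initial phase point. *)
pose eta := Num.min (Num.min e delta) (Num.min (d / (C + 1)) (e / (2 * (C + 1)))).
have C1 : 0 < C + 1 by rewrite ltr_wpDl.
have eta0 : 0 < eta by rewrite !lt_min e0 delta0 !divr_gt0 // mulr_gt0.
have [rho rho0 rhoP] := join_length_small Bx v1 eta0.
pose N := 2 * (`|v| + `|z|) + 1.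
have N0 : 0 < N by rewrite ltr_wpDl // mulr_ge0 // addr_ge0.
pose s := Num.min (Num.min 1 d) (rho / (2 * N)).
have s0 : 0 < s by rewrite !lt_min ltr01 d0 divr_gt0 // mulr_gt0.
have s1 : s <= 1 by rewrite !ge_min lexx.
have sd : s <= d by rewrite !ge_min lexx orbT.
have sN : s * N < rho.
  have : s <= rho / (2 * N) by rewrite !ge_min lexx !orbT.
  rewrite ler_pdivlMr; last by rewrite mulr_gt0.
  nra.
pose y := circle_point x v s.
have by_ : Mbd y by exact: circle_point_Mbd.
pose q := s ^+ 2 * sqnorm v.
have q0 : 0 <= q by rewrite mulr_ge0 ?sqr_ge0 ?sqnorm_ge0.
have q1 : 0 < 1 + q by rewrite ltr_wpDr.
pose a := 2 * s / (1 + q).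
have a0 : 0 < a by rewrite divr_gt0 // mulr_gt0.
have a2 : a <= 2 * s.
  by rewrite ler_pdivrMr // ler_peMr ?lerDl // mulr_ge0 // ltW.
pose u := v - s *: z.
have yu : y - x = a *: u by exact: circle_point_sub.
clearbody y.
have yx : `|y - x| < rho.
  apply: le_lt_trans sN; rewrite yu normrZ gtr0_norm //.
  have uB : `|u| <= `|v| + `|z|.
    rewrite (le_trans (ler_normB _ _)) // lerD2l normrZ (gtr0_norm s0).
    by rewrite ler_piMl.
  have := ler_pM (ltW a0) (normr_ge0 u) a2 uB.
  rewrite /N; nra.
have [l [c [[l0 geo SMc [cx cy] cint] le]]] := rhoP y (Mbd_Mball by_) yx.
have [le1 le2 le3 le4] : [/\ l < e, l < delta, l < d / (C + 1) & l < e / (2 * (C + 1))].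
  by move: le; rewrite !lt_min => /andP[/andP[-> ->] /andP[-> ->]].
(* If l = 0, then y = x and v is a multiple of x; being tangential as well, it would vanish, against
   its unit length. *)
have lpos : 0 < l.
  rewrite lt_neqAle l0 andbT; apply/eqP => l0'.
  have : y - x = 0 by rewrite -cy -l0' cx subrr.
  rewrite yu => /eqP; rewrite scaler_eq0 gt_eqF //= subr_eq0 => /eqP vz.
  have v0 : v = 0.
    have : dotp x v = s * sqnorm v.
      transitivity (s * sqnorm v * sqnorm x); last by rewrite bx mulr1.
      rewrite {1}vz /z; move: (sqnorm v) => k.
      by rewrite /dotp /sqnorm mulr_sumr; apply: eq_bigr => i _; rewrite !mxE; ring.
    rewrite xv => /esym/eqP; rewrite mulf_eq0 gt_eqF //= => /eqP k0.
    by rewrite vz /z k0 scale0r scaler0.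
  by move/eqP: v1; rewrite v0 /inner !mul0mx mxE eq_sym oner_eq0.
set w := (c 0).2.
have w1 : inner g x w w = 1 by case: SMc => _; rewrite cx.
have wB : `|w| <= B by exact: BP.
have est := CP l c (ltW le2) geo wB.
(* The remainder is O(l^2), so after division by l it is O(l). *)
pose r := l^-1 *: (y - x - l *: w).
have rd : `|r| <= C * l.
  apply: norm_le_coord => [|i]; first by rewrite mulr_ge0.
  have [_ /(_ i)] := est l (introT andP (conj l0 (lexx l))).
  rewrite cy cx -/w => h.
  rewrite /r !mxE normrM normfV (gtr0_norm lpos) mulrC ler_pdivrMr //.
  by apply: le_trans h _; rewrite expr2 mulrA.
have wv : `|w - v| < e / 2.
  apply: (dP s (l^-1 * a) w r) => //; first exact: ltW.
  - by rewrite mulr_ge0 ?invr_ge0 // ltW.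
  - rewrite (le_trans rd) //; move: le3; rewrite ltr_pdivlMr //; nra.
  - rewrite -scalerA -yu /r; move: (y - x) => D.
    rewrite scalerBr scalerA mulVf ?gt_eqF // scale1r.
    by rewrite addrC subrK.
exists l, c; split => //; first by rewrite lpos.
- by rewrite cy.
- move=> t tl; have [h _] := est t tl; have [t0 tl'] := andP tl.
  have -> : c t - (x, v) = (c t - c 0) + (c 0 - (x, v)) by rewrite subrKA.
  rewrite (le_lt_trans (ler_normD _ _)) //.
  have -> : `|c 0 - (x, v)| = `|w - v|.
    by rewrite prod_normE /= cx subrr normr0 max_r.
  have : C * t <= e / 2.
    move: le4; rewrite ltr_pdivlMr ?mulr_gt0 // => le4.
    have := ler_wpM2l C0 tl'; nra.
  lra.
Qed.

End Chords.

(** * Vanishing on tangent vectors *)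

Section BoundaryDetermination.
Local Open Scope classical_set_scope.
Local Open Scope ring_scope.
Context (R : realType) (n : nat).
Local Notation V := 'rV[R]_n.
Local Notation TM := ('rV[R]_n * 'rV[R]_n)%type.

Lemma dotp_bound (x v : V) : `|dotp x v| <= n%:R * (`|x| * `|v|).
Proof.
rewrite (le_trans (ler_norm_sum _ _ _)) // mulr_natl -[X in _ *+ X]card_ord -sumr_const.
by apply: ler_sum => i _; rewrite normrM; apply: ler_pM => //; exact: coord_le_norm.
Qed.

Lemma dotpBr (x v w : V) : dotp x (v - w) = dotp x v - dotp x w.
Proof. by rewrite /dotp -sumrB; apply: eq_bigr => i _; rewrite !mxE mulrBr. Qed.

Lemma dotpBl (x v w : V) : dotp (v - w) x = dotp v x - dotp w x.
Proof. by rewrite /dotp -sumrB; apply: eq_bigr => i _; rewrite !mxE mulrBl. Qed.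

Lemma dotpZr (x v : V) a : dotp x (a *: v) = a * dotp x v.
Proof. by rewrite /dotp mulr_sumr; apply: eq_bigr => i _; rewrite !mxE mulrCA. Qed.

Lemma dotpZl (x v : V) a : dotp (a *: x) v = a * dotp x v.
Proof. by rewrite /dotp mulr_sumr; apply: eq_bigr => i _; rewrite !mxE mulrA. Qed.

Lemma dotp_sqnorm (x : V) : dotp x x = sqnorm x.
Proof. by apply: eq_bigr => i _; rewrite expr2. Qed.

Lemma sqnorm_boundary_dist (x y : V) : Mbd x -> Mball y ->
  1 - sqnorm y <= 2 * n%:R * `|y - x|.
Proof.
move=> bx By; have Bx := Mbd_Mball bx.
have -> : 1 - sqnorm y = dotp x (x - y) + dotp (x - y) y.
  by rewrite dotpBr dotpBl !dotp_sqnorm bx; ring.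
have x1 := Mball_norm Bx; have y1 := Mball_norm By.
rewrite (distrC y); set k := `|x - y|.
have h1 : `|dotp x (x - y)| <= n%:R * k.
  by rewrite (le_trans (dotp_bound _ _)) // ler_wpM2l // ler_piMl.
have h2 : `|dotp (x - y) y| <= n%:R * k.
  by rewrite (le_trans (dotp_bound _ _)) // ler_wpM2l // ler_piMr.
have := ler_norm (dotp x (x - y)); have := ler_norm (dotp (x - y) y); lra.
Qed.

(** Project y radially to the sphere, then w to the tangent space there. With b = |y|^2 - 1 along a
    geodesic, the two errors are bounded by |b| and |b'|. The lower bound on |y|^2 makes the radial
    factor at most 2. *)
Lemma tangential_foot (y w : V) : Mball y -> 1 / 4 <= sqnorm y ->
  exists y' w', [/\ Mbd y', dotp y' w' = 0, `|y - y'| <= 1 - sqnorm y &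
    `|w - w'| <= 2 * `|dotp y w|].
Proof.
move=> By y4; pose s := Num.sqrt (sqnorm y).
have ss : s ^+ 2 = sqnorm y by rewrite sqr_sqrtr // sqnorm_ge0.
have s0 : 0 <= s by exact: sqrtr_ge0.
have s1 : s <= 1.
  have : s ^+ 2 <= 1 by rewrite ss.
  nra.
have s2 : 1 / 2 <= s.
  have : 1 / 4 <= s ^+ 2 by rewrite ss.
  nra.
have sp : 0 < s by lra.
pose y' := s^-1 *: y.
have by' : Mbd y'.
  rewrite /Mbd /= -dotp_sqnorm dotpZl dotpZr dotp_sqnorm -ss.
  by field; rewrite gt_eqF.
have y'1 := Mball_norm (Mbd_Mball by').
exists y', (w - dotp y' w *: y'); split => //.
- by rewrite dotpBr dotpZr dotp_sqnorm by' mulr1 subrr.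
- have -> : y - y' = (s - 1) *: y'.
    by rewrite /y' scalerA mulrBl mulfV ?gt_eqF // mul1r scalerBl scale1r.
  rewrite normrZ ler0_norm ?subr_le0 // opprB -ss.
  apply: (@le_trans _ _ (1 - s)); first by rewrite ler_piMr // subr_ge0.
  nra.
- rewrite subKr normrZ.
  apply: (@le_trans _ _ `|dotp y' w|); first by rewrite ler_piMr.
  rewrite dotpZl normrM ler_wpM2r // ger0_norm ?invr_ge0 //.
  by rewrite -[2]invrK lef_pV2 ?posrE ?invr_gt0 //; lra.
Qed.

Variable g : V -> 'M[R]_n.
Hypothesis gC11 : C11_metric g.
Hypothesis joinable : uniquely_joined g.

(** If [bending] were nonpositive at all tangent vectors near (x, v), its Lipschitz continuity and
    the tangential foot of each phase point of a short chord would give b'' <= C (-b + |b'|),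
    contrary to [short_maximum_principle]. *)
Lemma strictly_convex_dense x v (e : R) :
  Mbd x -> dotp x v = 0 -> inner g x v v = 1 -> 0 < e ->
  exists y w, [/\ Mbd y, dotp y w = 0, `|(y, w) - (x, v)| < e & 0 < bending g (y, w)].
Proof.
move=> bx xv v1 e0; apply: contrapT => nex.
pose e1 := Num.min e 1.
have e10 : 0 < e1 by rewrite lt_min e0 ltr01.
have flat y w : Mbd y -> dotp y w = 0 -> `|(y, w) - (x, v)| < e1 -> bending g (y, w) <= 0.
  move=> by_ yw; rewrite lt_min => /andP[yx _]; rewrite leNgt; apply/negP => pos.
  by apply: nex; exists y, w.
pose B := `|v| + 2.
have [K K0 [_ KL]] := bounded_lipschitz_bending gC11 B.
(* b'' is 2 times [bending], whence the factor 2; the 1 secures the condition 1 <= C of the maximum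
   principle. *)
pose C := 2 * K + 1; have C1 : 1 <= C by rewrite /C lerDr mulr_ge0.
(* N eps dominates the distance from (x, v) to the tangential foot of any point of the chord: eps to
   the point, 2 n eps for the radial projection and 2 n (B + 1) eps for the tangential one. The
   choice of [eps] keeps the feet where [bending] is nonpositive, |y|^2 at least 1 / 2, and 2 C l
   below 1. *)
pose N := 4 + 2 * n%:R + 2 * n%:R * (B + 1).
have B1 : 0 <= B by rewrite addr_ge0.
have nB : 0 <= n%:R * B by rewrite mulr_ge0.
have n0 : 0 <= n%:R :> R by [].
have N0 : 0 < N by rewrite /N; nra.
pose eps := Num.min (Num.min 1 (2 * C + 1)^-1) (Num.min (e1 / N) (2 * N)^-1).
have eps0 : 0 < eps.
  by rewrite !lt_min ltr01 !invr_gt0 divr_gt0 // mulr_gt0 // ltr_wpDl // mulr_ge0 // (le_trans ler01).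
have eps1 : eps <= 1 by rewrite !ge_min lexx.
have epsC : eps <= (2 * C + 1)^-1 by rewrite !ge_min lexx orbT.
have epse : eps * N <= e1.
  by rewrite -ler_pdivlMr // !ge_min lexx !orbT.
have epsN : eps * N <= 1 / 2.
  have : eps <= (2 * N)^-1 by rewrite !ge_min lexx !orbT.
  rewrite -[(_ * _)^-1]mul1r ler_pdivlMr ?mulr_gt0 //; lra.
have [l [c [/andP[l0 le] geo [_ cx] [cy cint] cnear]]] := short_chord gC11 joinable bx xv v1 eps0.
have x1 := Mball_norm (Mbd_Mball bx).
apply: (@short_maximum_principle R C l (fun s => sqnorm (c s).1 - 1)
  (fun s => 2 * dotp (c s).1 (c s).2) (fun s => 2 * bending g (c s))) => //.
- have : l * (2 * C + 1) < 1.
    by rewrite -ltr_pdivlMr ?mul1r ?(lt_le_trans le) // ltr_wpDl // mulr_ge0 // (le_trans ler01).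
  lra.
- exact: geodesic_sqnorm_continuous geo.
- by move=> t tl; exact (geodesic_sqnorm_derive geo tl).
- by move=> t tl; exact (geodesic_dotp_derive geo tl).
- by rewrite cx bx subrr.
- by rewrite cy subrr.
- by move=> t /cint; rewrite subr_lt0.
move=> t /andP[t0 tl]; have tl' : 0 <= t <= l by rewrite !ltW.
have ct := cnear t tl'; have Bt := geodesic_Mball geo tl'.
move: ct Bt; case: (c t) => y w /= ct By.
have yx : `|y - x| <= eps := le_trans (norm_fst_le ((y, w) - (x, v))) (ltW ct).
have wv : `|w - v| <= eps := le_trans (norm_snd_le ((y, w) - (x, v))) (ltW ct).
have y1 := Mball_norm By.
have wB : `|w| <= `|v| + 1.
  rewrite -(subrK v w) addrC (le_trans (ler_normD _ _)) // lerD2l (le_trans wv) //.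
have defect : 1 - sqnorm y <= 2 * n%:R * eps.
  by rewrite (le_trans (sqnorm_boundary_dist bx By)) // ler_wpM2l ?mulr_ge0.
have ndot : `|dotp y w| <= n%:R * (B + 1) * eps.
  have -> : dotp y w = dotp (y - x) w + dotp x (w - v).
    by rewrite dotpBl dotpBr xv; ring.
  rewrite (le_trans (ler_normD _ _)) //.
  have h1 : `|dotp (y - x) w| <= n%:R * (eps * B).
    rewrite (le_trans (dotp_bound _ _)) // ler_wpM2l // ler_pM // (le_trans wB) //.
    by rewrite /B lerD2l; lra.
  have h2 : `|dotp x (w - v)| <= n%:R * (1 * eps).
    by rewrite (le_trans (dotp_bound _ _)) // ler_wpM2l // ler_pM.
  have -> : n%:R * (B + 1) * eps = n%:R * (eps * B) + n%:R * (1 * eps) by ring.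
  exact: lerD.
have epsn : 2 * n%:R * eps <= 1 / 2 by move: epsN; rewrite /N; nra.
have [||y' [w' [by' yw' yy' ww']]] := @tangential_foot y w => //; first by lra.
have sy1 : 0 <= 1 - sqnorm y by rewrite subr_ge0.
have foot : `|(y, w) - (y', w')| <= (1 - sqnorm y) + 2 * `|dotp y w|.
  rewrite prod_normE /= ge_max; apply/andP; split.
    by rewrite (le_trans yy') // lerDl mulr_ge0.
  by rewrite (le_trans ww') // lerDr.
have near' : `|(y', w') - (x, v)| < e1.
  rewrite -(subrKA (y, w)) (le_lt_trans (ler_normD _ _)) // distrC.
  apply: lt_le_trans epse.
  have := lerD (le_trans foot (lerD defect (ler_wpM2l (ler0n R 2) ndot))) (ltW ct).
  move=> h; apply: (le_lt_trans h); rewrite /N.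
  nra.
have A1 : phase_ball B (y, w).
  by split => //=; rewrite (le_trans wB) // lerD2l; lra.
have A2 : phase_ball B (y', w').
  split => /=; first exact: Mbd_Mball.
  have : `|w' - v| < e1 := le_lt_trans (norm_snd_le ((y', w') - (x, v))) near'.
  rewrite lt_min => /andP[_ wv1].
  rewrite -(subrK v w') addrC (le_trans (ler_normD _ _)) // lerD2l; lra.
have S0 := flat _ _ by' yw' near'.
have := le_trans (ler_norm _) (KL _ _ A1 A2).
have := ler_wpM2l K0 foot.
set b1 := bending g (y, w); set b2 := bending g (y', w') in S0 *.
set D := 1 - sqnorm y in sy1 *; rewrite normrM (ger0_norm (ler0n R 2)).
have -> : - (sqnorm y - 1) = D by rewrite opprB.
have := normr_ge0 (dotp y w); move: `|dotp y w| `|_ - _| => p P p0 h1 h2.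
rewrite /C; nra.
Qed.

End BoundaryDetermination.

(** * Vanishing in strictly convex directions, extended by density *)

Section VanishingOnTangentVectors.
Local Open Scope classical_set_scope.
Local Open Scope ring_scope.
Context (R : realType) (n : nat).
Local Notation V := 'rV[R]_n.
Local Notation TM := ('rV[R]_n * 'rV[R]_n)%type.
Variable g : V -> 'M[R]_n.
Hypothesis gC11 : C11_metric g.
Hypothesis joinable : uniquely_joined g.

Lemma phase_ball_near (x v : V) (z : TM) (e : R) : Mball z.1 -> e <= 1 ->
  `|z - (x, v)| <= e -> phase_ball (`|v| + 1) z.
Proof.
move=> Bz e1 zx; split => //.
have : `|z.2 - v| <= e := le_trans (norm_snd_le (z - (x, v))) zx.
rewrite -[in X in _ -> X](subrK v z.2) => h.
by rewrite (le_trans (ler_normD _ _)) // addrC lerD2l (le_trans h).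
Qed.

Lemma bounded_lipschitz_near (F : TM -> R) (x v : V) (d : R) :
  bounded_lipschitz (phase_ball (`|v| + 1)) F -> Mball x -> 0 < d ->
  exists2 r : R, 0 < r <= 1 & forall z, Mball z.1 -> `|z - (x, v)| <= r ->
    `|F z - F (x, v)| <= d.
Proof.
move=> [K K0 [_ KL]] Bx d0; have K1 : 0 < K + 1 by rewrite ltr_wpDl.
exists (Num.min 1 (d / (K + 1))).
  by rewrite lt_min ltr01 divr_gt0 //= ge_min lexx.
move=> z Bz zx; have r1 : Num.min 1 (d / (K + 1)) <= 1 by rewrite ge_min lexx.
have r2 : Num.min 1 (d / (K + 1)) <= d / (K + 1) by rewrite ge_min lexx orbT.
have Az := phase_ball_near Bz r1 zx.
have Ax : phase_ball (`|v| + 1) (x, v) by split => //=; rewrite lerDl.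
rewrite (le_trans (KL _ _ Az Ax)) //.
have := le_trans zx r2; rewrite ler_pdivlMr // mulrC; apply: le_trans.
by rewrite ler_wpM2r // lerDl.
Qed.

(* [flow g z] takes the default value [cst z] if no geodesic from [z] exists on
   the whole lifespan; it stays near [z] all the same. *)
Lemma flow_geodesic_or_cst z T : (forall t, 0 <= t <= T -> lifespan g z t) ->
  Mball z.1 -> geodesic_on g `[0, T] (flow g z) /\ flow g z 0 = z \/ flow g z = cst z.
Proof.
move=> lT Bz.
have [ex|nex] := pselect (exists c, [set c | c 0 = z /\ geodesic_on g (lifespan g z) c] c).
  left; have [h0 geo] := xgetPex (cst z) ex; split => //.
  by apply: geodesic_on_sub geo => t /=; rewrite in_itv; exact: lT.
right; apply: xgetPN => c hc; apply: nex; by exists c.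
Qed.

Variable (m : nat) (f : V -> tensor R n m.+1).
Hypothesis fC11 : C11_field f.
Hypothesis If0 : xray_vanishes g f.

(** By contradiction: if a is nonzero, f stays within |a| / 2 of a on the whole flow line from the
    initial vector of a short chord, so its integral is nonzero. The lower bound [convex] serves
    twice: on the chord it forces a strictly inward start, and on any geodesic from there it bounds
    the exit time. *)
Lemma eval_eq0_of_strictly_convex x v : Mbd x -> dotp x v = 0 ->
  inner g x v v = 1 -> 0 < bending g (x, v) -> eval_field f (x, v) = 0.
Proof.
move=> bx xv v1 s0; have Bx := Mbd_Mball bx.
apply/eqP; apply: contraT => a0; set a := eval_field f (x, v) in a0.
set s := bending g (x, v) in s0.
have a20 : 0 < `|a| / 2 by rewrite divr_gt0 // normr_gt0.
have [r1 /andP[r10 r11] r1P] := bounded_lipschitz_near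
  (bounded_lipschitz_bending gC11 (`|v| + 1)) Bx (divr_gt0 s0 (ltr0n R 2)).
have [r2 /andP[r20 r21] r2P] := bounded_lipschitz_near
  (bounded_lipschitz_eval (`|v| + 1) fC11) Bx a20.
pose r := Num.min r1 r2.
have r0 : 0 < r by rewrite lt_min r10.
have rr1 : r <= r1 by rewrite ge_min lexx.
have rr2 : r <= r2 by rewrite ge_min lexx orbT.
have bend z : Mball z.1 -> `|z - (x, v)| <= r -> s / 2 <= bending g z.
  move=> Bz zx; have := r1P z Bz (le_trans zx rr1).
  by rewrite ler_norml -/s => /andP[+ _]; lra.
have fnear z : Mball z.1 -> `|z - (x, v)| <= r -> `|eval_field f z - a| <= `|a| / 2.
  by move=> Bz zx; exact: r2P z Bz (le_trans zx rr2).
have B0 : 0 <= `|v| + 1 by rewrite addr_ge0.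
have [delta delta0 [C C0 CP]] := geodesic_short_time gC11 B0.
have C1 : 0 < 2 * (C + 1) by rewrite mulr_gt0 // ltr_wpDl.
(* Up to time [eta] a geodesic moves by at most r / 2, and [eps] puts z within r / 2 of (x, v). *)
pose eta := Num.min delta (r / (2 * (C + 1))).
have eta0 : 0 < eta by rewrite lt_min delta0 divr_gt0.
have etad : eta <= delta by rewrite ge_min lexx.
have etaC : C * eta <= r / 2.
  have : eta <= r / (2 * (C + 1)) by rewrite ge_min lexx orbT.
  rewrite ler_pdivlMr //; nra.
have n1 : 0 < 4 * (n%:R + 1) :> R by rewrite mulr_gt0 // ltr_wpDl.
(* The inward slope 2 x . z.2 is at most 2 n eps in size, so with this choice the convex term s eta
   / 2 outweighs it at time [eta], and the geodesic must have left the ball. *)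
pose eps := Num.min (r / 2) (s * eta / (4 * (n%:R + 1))).
have eps0 : 0 < eps by rewrite lt_min !divr_gt0 // mulr_gt0.
have epsr : eps <= r / 2 by rewrite ge_min lexx.
have epss : 2 * n%:R * eps < s * eta / 2.
  have : eps <= s * eta / (4 * (n%:R + 1)) by rewrite ge_min lexx orbT.
  rewrite ler_pdivlMr //; have : 0 <= n%:R :> R by []; nra.
have [l [c [/andP[l0 le] geo [SMc cx] [cy cint] cnear]]] :=
  short_chord gC11 joinable bx xv v1 eps0.
set z := c 0 in SMc cx.
have l00 : 0 <= (0 : R) <= l by rewrite lexx ltW.
have zx : `|z - (x, v)| < eps := cnear 0 l00.
have zB : `|z.2| <= `|v| + 1.
  have [] // := @phase_ball_near x v z r SMc.1 (le_trans rr1 r11) _.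
  by rewrite (le_trans (ltW zx)) //; lra.
have convex T c' : 0 <= T -> geodesic_on g `[0, T] c' -> c' 0 = z ->
    (forall t, 0 <= t <= T -> `|c' t - (x, v)| <= r) ->
    2 * dotp x z.2 * T + s / 2 * T ^+ 2 <= sqnorm (c' T).1 - 1.
  move=> T0 geo' cz cr.
  have := taylor2_lower T0 (geodesic_sqnorm_continuous geo')
    (geodesic_dotp_continuous geo')
    (fun t tT => geodesic_sqnorm_derive geo' tT)
    (fun t tT => geodesic_dotp_derive geo' tT) (s := s).
  rewrite cz cx bx subrr add0r [2^-1 * s]mulrC; apply => t /andP[t0 tT].
  have tT' : 0 <= t <= T by rewrite !ltW.
  by have := bend _ (geodesic_Mball geo' tT') (cr _ tT'); lra.
have zin : dotp x z.2 < 0.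
  have cr t : 0 <= t <= l -> `|c t - (x, v)| <= r.
    by move=> tl; have := cnear t tl; lra.
  have := convex l c (ltW l0) geo erefl cr.
  rewrite cy subrr; have : 0 < s / 2 * l ^+ 2 by rewrite mulr_gt0 ?divr_gt0 ?exprn_gt0.
  move=> h1 h2; have : 2 * dotp x z.2 * l < 0 by lra.
  by rewrite pmulr_llt0 // pmulr_rlt0.
have zin' : bdinSM g z.
  by split; [split => //; rewrite cx|rewrite cx].
have near_z T c' : geodesic_on g `[0, T] c' -> c' 0 = z -> T <= eta ->
    forall t, 0 <= t <= T -> `|c' t - (x, v)| <= r.
  move=> geo' cz Te t tT; have [t0 tT'] := andP tT.
  have cB : `|(c' 0).2| <= `|v| + 1 by rewrite cz.
  have [h _] := CP T c' (le_trans Te etad) geo' cB t tT.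
  rewrite -(subrKA (c' 0)) (le_trans (ler_normD _ _)) //.
  have : C * t <= C * eta by rewrite ler_wpM2l // (le_trans tT').
  by move: h; rewrite cz; have := ltW zx; lra.
have exit T c' : geodesic_on g `[0, T] c' -> c' 0 = z -> T <= eta.
  move=> geo' cz; rewrite leNgt; apply/negP => eT.
  have geo2 : geodesic_on g `[0, eta] c'.
    by apply: geodesic_on_sub geo'; apply: subset_itvl; rewrite bnd_simp ltW.
  have := convex eta c' (ltW eta0) geo2 cz (near_z _ _ geo2 cz (lexx _)).
  have eta00 : 0 <= eta <= eta by rewrite lexx ltW.
  have : sqnorm (c' eta).1 - 1 <= 0 by rewrite subr_le0; exact (geodesic_Mball geo2 eta00).
  have : `|dotp x z.2| <= n%:R * eps.
    have -> : dotp x z.2 = dotp x (z.2 - v) by rewrite dotpBr xv subr0.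
    rewrite (le_trans (dotp_bound _ _)) // ler_wpM2l //.
    have h1 := Mball_norm Bx.
    have h2 : `|z.2 - v| <= eps := le_trans (norm_snd_le (z - (x, v))) (ltW zx).
    by rewrite -[eps]mul1r ler_pM.
  rewrite ler_norml => /andP[h1 _] h2 h3.
  have : 0 < 2 * dotp x z.2 + s / 2 * eta by lra.
  have -> : 2 * dotp x z.2 + s / 2 * eta = (2 * dotp x z.2 * eta + s / 2 * eta ^+ 2) / eta.
    by field; rewrite gt_eqF.
  by rewrite pmulr_lgt0 ?invr_gt0 // ltNge (le_trans h3 h2).
have tau_le : (tau_plus g z <= eta%:E)%E.
  apply: ge_ereal_sup => _ [T [T0 [c' [cz geo']]] <-].
  by rewrite lee_fin; exact: exit geo' cz.
(* The chord itself is admissible in the supremum, so the travel time is positive and the integral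
   is over a nondegenerate interval. *)
have tau_ge : (l%:E <= tau_plus g z)%E.
  by apply: ereal_sup_ubound; exists l => //; split; [exact: ltW|exists c].
have tauE : tau_plus g z = (travel_time g z)%:E.
  rewrite /travel_time fineK // fin_numE; apply/andP; split; apply/eqP => E.
    by move: tau_ge; rewrite E.
  by move: tau_le; rewrite E.
set tau := travel_time g z in tauE.
move: tau_le tau_ge; rewrite tauE !lee_fin => tau_le tau_ge.
have tau0 : 0 < tau := lt_le_trans l0 tau_ge.
have Bz : Mball z.1 by case: SMc.
have life t : 0 <= t <= tau -> lifespan g z t.
  move=> /andP[t0 tt]; split; last by rewrite tauE lee_fin.
  apply: (@le_trans _ _ 0%E); last by rewrite lee_fin.
  rewrite leeNl oppe0; apply: ereal_sup_ubound; exists 0 => //; split => //.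
  by exists (cst z); split => //; rewrite oppr0; exact: geodesic_on_point.
have [cflow flow_near flowB] : [/\ {within `[0, tau], continuous (flow g z)},
    forall t, 0 <= t <= tau -> `|flow g z t - (x, v)| <= r &
    forall t, 0 <= t <= tau -> Mball (flow g z t).1].
  have [[geo' cz]|->] := flow_geodesic_or_cst life Bz.
    split; first by case: geo'.
      by move=> t tt; exact (near_z _ _ geo' cz tau_le t tt).
    by move=> t tt; exact (geodesic_Mball geo' tt).
  split => //; first by apply: continuous_subspaceT; exact: cst_continuous.
  by move=> t _ /=; rewrite (le_trans (ltW zx)) //; lra.
have cint' : {within `[0, tau], continuous (eval_field f \o flow g z)}.
  apply: (bounded_lipschitz_comp_continuous (bounded_lipschitz_eval (`|v| + 1) fC11)) cflow.
  move=> t /=; rewrite in_itv /= => tt.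
  exact: phase_ball_near (flowB t tt) (le_trans rr1 r11) (flow_near t tt).
have := If0 zin'; rewrite /integral_fun => /eqP.
by rewrite (negbTE (Rintegral_neq0 tau0 a0 cint' (fun t tt => fnear _ (flowB t tt) (flow_near t tt)))).
Qed.

Lemma bendingZ x v (k : R) : bending g (x, k *: v) = k ^+ 2 * bending g (x, v).
Proof.
rewrite /bending mulr_sumr; apply: eq_bigr => i _ /=.
have -> : chris g x (k *: v) (k *: v) 0 i = k ^+ 2 * chris g x v v 0 i.
  rewrite !mxE mulr_sumr; apply: eq_bigr => j _.
  by rewrite mulr_sumr; apply: eq_bigr => l _; rewrite !mxE; ring.
by rewrite !mxE; ring.
Qed.

Lemma normalize_tangent x v : Mball x -> v != 0 ->
  exists2 k : R, 0 < k & inner g x (k *: v) (k *: v) = 1.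
Proof.
move=> Bx v0; have N0 : 0 < inner g x v v by case: gC11 => _ _; exact.
exists (Num.sqrt (inner g x v v))^-1; first by rewrite invr_gt0 sqrtr_gt0.
rewrite innerZl (innerZr gC11 Bx) mulrA -expr2 exprVn sqr_sqrtr ?(ltW N0) //.
by rewrite mulVf // gt_eqF.
Qed.

(** Approximate (x, v) by strictly convex tangent vectors (y, w). These need not be unit, but
    [bending] and the form of f are homogeneous in w, so rescaling gives f(y, w) = 0; a nonzero f(x,
    v) would then be at most half its own size. *)
Lemma eval_eq0_of_unit x v : Mbd x -> dotp x v = 0 -> inner g x v v = 1 ->
  eval_field f (x, v) = 0.
Proof.
move=> bx xv v1; apply/eqP; apply: contraT => a0.
have a20 : 0 < `|eval_field f (x, v)| / 2 by rewrite divr_gt0 // normr_gt0.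
have [r /andP[r0 _] rP] := bounded_lipschitz_near
  (bounded_lipschitz_eval (`|v| + 1) fC11) (Mbd_Mball bx) a20.
have [y [w [by_ yw near_ pos]]] := strictly_convex_dense gC11 joinable bx xv v1 r0.
have w0 : w != 0.
  apply: contraTneq pos => ->.
  by rewrite -(scale0r (0 : V)) bendingZ expr0n mul0r ltxx.
have [k k0 kw] := normalize_tangent (Mbd_Mball by_) w0.
have ykw : dotp y (k *: w) = 0 by rewrite dotpZr yw mulr0.
have posk : 0 < bending g (y, k *: w) by rewrite bendingZ mulr_gt0 ?exprn_gt0.
have := eval_eq0_of_strictly_convex by_ ykw kw posk.
rewrite -[eval_field _ _]/(tensor_form (f y) (k *: w)) tensor_formZ => /eqP.
rewrite mulf_eq0 expf_eq0 gt_eqF //= => /eqP fw.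
have := rP (y, w) (Mbd_Mball by_) (ltW near_).
rewrite -[eval_field f (y, w)]/(tensor_form (f y) w) fw sub0r normrN.
by move: a20; lra.
Qed.

Lemma tensor_form_tangent_eq0 x v : Mbd x -> dotp x v = 0 -> tensor_form (f x) v = 0.
Proof.
move=> bx xv; have [->|v0] := eqVneq v 0.
  by rewrite -(scale0r (0 : V)) tensor_formZ expr0n mul0r.
have [k k0 kv] := normalize_tangent (Mbd_Mball bx) v0.
have xkv : dotp x (k *: v) = 0 by rewrite dotpZr xv mulr0.
have := eval_eq0_of_unit bx xkv kv.
rewrite -[eval_field _ _]/(tensor_form (f x) (k *: v)) tensor_formZ => /eqP.
by rewrite mulf_eq0 expf_eq0 gt_eqF //= => /eqP.
Qed.

End VanishingOnTangentVectors.

Local Open Scope ring_scope.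

Theorem lemma2 (R : realType) (n : nat) (hn : (2 <= n)%N)
    (g : 'rV[R]_n -> 'M[R]_n) (hg : simple_C11 g)
    (m : nat) (f : 'rV[R]_n -> tensor R n m.+1)
    (fsym : symmetric_field f) (fC11 : C11_field f)
    (If0 : xray_vanishes g f) :
  exists p : 'rV[R]_n -> tensor R n m,
    [/\ symmetric_field p, C11_field p,
        (forall x, Mbd x -> forall J, f x J = symmetrize (nabla g p x) J) &
        (forall x, Mbd x -> forall J, p x J = 0)].
Proof.
case: hg => gC11 _ joinable _.
apply: boundary_potential => // x v bx xv.
exact (tensor_form_tangent_eq0 gC11 joinable fC11 If0 bx xv).
Qed.
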